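(* Let $n\ge 2$ be an integer and let $L,\lambda_1,\dots,\lambda_n$ be positive real numbers. For $1\le i\le n$ let $C_i\in[\lambda_i]$ be either a convex tangential polygon in $\mathbb{R}^2$ whose inscribed circle has radius $r_i$, or a circle of radius $r_i$. Let the bounded regions $D_i$ with boundaries $C_i$ be pairwise disjoint, and let the total length of the curves $C_1,\dots,C_n$ be $L$. Then the total area $A$ of the set $\bigcup_{i=1}^n D_i$ takes its smallest value (among all such $n$-tuples of curves with the same $n,L,\lambda_1,\dots,\lambda_n$) if and only if $r_1=r_2=\dots=r_n$.
   Context: For a simple closed rectifiable curve $C$ in $\mathbb{R}^2$ with arc length $\ell$, let $a$ be the area of the bounded region with boundary $C$. For a positive real number $\lambda$, the curve $C$ belongs to the class $[\lambda]$ if $a=\lambda \ell^2$. A polygon is called tangential if a circle can be inscribed into it, i.e. there is a circle (the inscribed circle) tangent to every side of the polygon. *)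

(* Defs.v *)
(* Library: MathComp + MathComp-Analysis. *)
From HB Require Import structures.
From mathcomp Require Import all_boot all_order all_algebra.
From mathcomp Require Import all_classical all_reals all_analysis.

Set Implicit Arguments.
Unset Strict Implicit.
Unset Printing Implicit Defensive.

Import Order.TTheory GRing.Theory Num.Theory.
Import numFieldNormedType.Exports.

Local Open Scope classical_set_scope.
Local Open Scope ring_scope.

Section plane_curves.
Context {R : realType}.
Implicit Types (C : R -> R * R) (D : set (R * R)) (p q o : R * R).
Implicit Types (vs : seq (R * R)) (r lambda : R).

(* The library norm on the product R * R is the sup norm, which induces the
   usual topology and bounded sets; lengths need the Euclidean distance. *)
Definition edist p q : R :=
  Num.sqrt ((p.1 - q.1) ^+ 2 + (p.2 - q.2) ^+ 2).

(* A curve is a path [0, 1] -> R * R; values outside [0, 1] are irrelevant. *)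
Definition curve_image C : set (R * R) := C @` `[0, 1].

Definition simple_closed C : Prop :=
  [/\ {within `[0, 1], continuous C}, C 0 = C 1 & set_inj `[0, 1[ C].

(* Length of the polygonal line inscribed in C at the parameters 0 :: s; same
   conventions as [variation], which is only available for real functions. *)
Definition inscribed_length C (s : seq R) : R :=
  let F := C \o nth 1 (0 :: s) in \sum_(0 <= k < size s) edist (F k.+1) (F k).

Definition arc_length C : \bar R :=
  ereal_sup [set (inscribed_length C s)%:E | s in itv_partition 0 1].

Definition rectifiable C : Prop := (arc_length C < +oo)%E.

Definition boundary D : set (R * R) := closure D `\` D°.

Definition is_bounded_region C D : Prop :=
  [/\ open D, connected D, bounded_set D & boundary D = curve_image C].

(* The bounded region with boundary C. By the Jordan curve theorem it exists
   and is unique when C is simple closed, so set0 is only a junk value. *)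
Definition region C : set (R * R) := xget set0 [set D | is_bounded_region C D].

Definition area D : \bar R := (lebesgue_measure \x lebesgue_measure)%E D.

Definition in_class lambda C : Prop :=
  [/\ simple_closed C, rectifiable C &
      area (region C) = (lambda%:E * (arc_length C * arc_length C))%E].

Definition circle_path o r (t : R) : R * R :=
  (o.1 + r * cos (2 * pi * t), o.2 + r * sin (2 * pi * t)).

Definition is_circle r C : Prop :=
  0 < r /\ exists o, {in `[0, 1], C =1 circle_path o r}.

(* Indices are taken cyclically. *)
Definition vertex vs (k : nat) : R * R := nth (0, 0) vs (k %% size vs).

Definition segment_point p q (s : R) : R * R :=
  ((1 - s) * p.1 + s * q.1, (1 - s) * p.2 + s * q.2).

(* The closed polygonal line through vs: with m = size vs, the side from vertex
   k to vertex k + 1 is run through affinely for t in [k / m, (k + 1) / m]. *)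
Definition polygon_path vs (t : R) : R * R :=
  let u := t * (size vs)%:R in
  let k := Num.truncn u in
  segment_point (vertex vs k) (vertex vs k.+1) (u - k%:R).

(* The circle with centre o and radius r touches the segment [p, q]: some point
   of the segment lies on the circle, and there the radius is perpendicular to
   the segment. *)
Definition tangent_to_segment o r p q : Prop :=
  exists2 s : R, 0 <= s <= 1 &
    let x := segment_point p q s in
    edist o x = r /\
    (x.1 - o.1) * (q.1 - p.1) + (x.2 - o.2) * (q.2 - p.2) = 0.

Definition inscribed_circle vs o r : Prop :=
  [/\ 0 < r,
      curve_image (circle_path o r) `<=` closure (region (polygon_path vs)) &
      forall k : nat, (k < size vs)%N ->
        tangent_to_segment o r (vertex vs k) (vertex vs k.+1)].

Definition convex_polygon vs : Prop :=
  [/\ (3 <= size vs)%N, simple_closed (polygon_path vs) &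
      convex_set (region (polygon_path vs) : set (convex_lmodType (R * R)%type))].

Definition is_convex_tangential_polygon r C : Prop :=
  exists vs, [/\ convex_polygon vs, exists o, inscribed_circle vs o r &
                 {in `[0, 1], C =1 polygon_path vs}].

(* The competing n-tuples of curves, r i being the radius attached to C i. *)
Definition admissible (n : nat) (L : R) (lambda : 'I_n -> R)
    (C : 'I_n -> R -> R * R) (r : 'I_n -> R) : Prop :=
  [/\ forall i, in_class (lambda i) (C i),
      forall i, is_convex_tangential_polygon (r i) (C i) \/
                is_circle (r i) (C i),
      trivIset setT (fun i => region (C i)) &
      (\sum_(i < n) arc_length (C i))%E = L%:E].

Definition total_area (n : nat) (C : 'I_n -> R -> R * R) : \bar R :=
  area (\bigcup_(i in [set: 'I_n]) region (C i)).

End plane_curves.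

(* Main.v *)
Require Import Defs.
From HB Require Import structures.
From mathcomp Require Import all_boot all_order all_algebra.
From mathcomp Require Import all_classical all_reals all_analysis.
From mathcomp Require Import measurable_realfun.
From mathcomp Require Import ring lra.

Set Implicit Arguments.
Unset Strict Implicit.
Unset Printing Implicit Defensive.

Import Order.TTheory GRing.Theory Num.Theory.
Import numFieldNormedType.Exports.

Local Open Scope classical_set_scope.
Local Open Scope ring_scope.

(** A circle of radius r and a convex polygon with an inscribed circle of radius r
have the same relation between the enclosed area a, the length l and r, namely
a = r l / 2. Together with a = lambda l ^ 2 this gives r = 2 lambda l, so that
equality of the radii means that all products lambda_i l_i agree. The total area
is the quadratic form sum_i lambda_i l_i ^ 2 in the lengths, and on the
hyperplane sum_i l_i = L it has exactly one minimum, the point m where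
lambda_i m_i does not depend on i: the value at any other l exceeds the value
at m by sum_i lambda_i (l_i - m_i) ^ 2 ([weighted_square_deviation]). This
settles the direction from equal radii to minimality. Conversely, if the given
tuple is minimal, then replacing each curve by its homothetic copy of length m_i
and moving the copies into disjoint vertical strips produces an admissible tuple
([admissible_rescale]), so l has to be equal to m.

The relation a = r l / 2 carries the geometric weight. For a polygon
([polygon_tangential_region]) the incenter z lies in the region D, and since D
is convex each ray from z meets the boundary exactly once. Hence D without z is
the disjoint union of cones over the half-open sides ([cone_decomposition]).
A cone is the affine image of a half-open unit triangle, so its area is half a
determinant ([area_affine], [area_cone]), and tangency makes this determinant
the product of r and the length of the side ([det2_tangent]). That the
length of the path, a supremum over inscribed lines, is the sum of the sides
follows from comparison with the cumulative length. For a circle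
([circle_tangential_region]) the area comes from integrating the lengths of the
vertical sections, and the length from inscribed regular polygons.

The region of a curve is a chosen bounded connected open set with the curve as
boundary. Two facts make it accessible without the Jordan curve theorem: it
exists for the given polygons because their area is positive, and a convex set of
this kind is the only one ([bounded_region_unique]). The second fact identifies
the region of a circle, and of a rescaled curve, with the expected set. *)

(* The bare name is taken by the extended distance of pseudometric spaces. *)
Local Notation edist := Defs.edist.

(* The plane with the product of the Borel sigma-algebras of the line. *)
Local Notation mplane R := (measurableTypeR R * measurableTypeR R)%type.

(** * Area under affine maps *)

Section affine_measure.
Context {R : realType}.
Local Notation mu := (@lebesgue_measure R).

Lemma measurable_affine (a b : R) :
  measurable_fun [set: measurableTypeR R]
    ((fun x => a * x + b) : measurableTypeR R -> measurableTypeR R).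
Proof.
apply: measurable_funD; last exact: measurable_cst.
by apply: measurable_funM; [exact: measurable_cst|exact: measurable_id].
Qed.

(** Both sides are measures in A, so it is enough to compare them on half-open
intervals. For negative a the preimage of such an interval is closed at the
other end, which does not change its length. *)
Lemma lebesgue_measure_affine (a b : R) (A : set (measurableTypeR R)) :
  a != 0 -> measurable A ->
  (`|a|%:E * mu ((fun x => a * x + b)%R @^-1` A) = mu A)%E.
Proof.
move=> a0 mA.
pose f : measurableTypeR R -> measurableTypeR R := fun x => a * x + b.
have mf : measurable_fun setT f by exact: measurable_affine.
have [nu nuE] : exists nu : {measure set (measurableTypeR R) -> \bar R},
    forall B, nu B = mu (f @^-1` B).
  by unshelve eexists; [apply: (pushforward mu f)|].
rewrite -nuE -[LHS]/(mscale (NngNum (normr_ge0 a)) nu A).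
apply/esym/lebesgue_measure_unique => //= _ [[c d]] _ <-.
rewrite /mscale nuE /=.
have [a_gt0|a_lt0|/eqP] := ltrgtP 0 a; last by rewrite eq_sym (negbTE a0).
- have -> : f @^-1` `]c, d]%classic = (`]((c - b) / a), ((d - b) / a)])%classic.
    apply/seteqP; split => x /=; rewrite !in_itv /f/=.
    + by rewrite ltr_pdivrMr // ler_pdivlMr // ltrBlDr lerBrDr mulrC.
    + by rewrite ltr_pdivrMr // ler_pdivlMr // ltrBlDr lerBrDr mulrC.
  rewrite !lebesgue_measure_itv/= !lte_fin ltr_pM2r ?invr_gt0// ltrD2r.
  case: ifP => _; last by rewrite mule0.
  by rewrite -!EFinB -EFinM gtr0_norm//; congr EFin; field.
- have -> : f @^-1` `]c, d]%classic = (`[((d - b) / a), ((c - b) / a)[)%classic.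
    apply/seteqP; split => x /=; rewrite !in_itv /f/=.
    + by rewrite ltr_ndivlMr // ler_ndivrMr // ltrBlDr lerBrDr mulrC andbC.
    + by rewrite ltr_ndivlMr // ler_ndivrMr // ltrBlDr lerBrDr mulrC andbC.
  rewrite !lebesgue_measure_itv/= !lte_fin ltr_nM2r ?invr_lt0// ltrD2r.
  case: ifP => _; last by rewrite mule0.
  by rewrite -!EFinB -EFinM ltr0_norm//; congr EFin; field.
Qed.

Lemma measurable_affine2 (a b c : R) :
  measurable_fun [set: mplane R]
    (fun p : mplane R => a * p.1 + b * p.2 + c : measurableTypeR R).
Proof.
apply: measurable_funD; last exact: measurable_cst.
apply: measurable_funD; (apply: measurable_funM; first exact: measurable_cst).
- exact: measurable_fst.
- exact: measurable_snd.
Qed.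

Lemma measurable_affine_map (a b c a' b' c' : R) :
  measurable_fun [set: mplane R]
    (fun p : mplane R => (a * p.1 + b * p.2 + c, a' * p.1 + b' * p.2 + c') : mplane R).
Proof. by apply: measurable_fun_pair; exact: measurable_affine2. Qed.

Lemma measurable_preimage_affine (a b c a' b' c' : R) (A : set (mplane R)) :
  measurable A -> measurable
   ((fun p : mplane R =>
       (a * p.1 + b * p.2 + c, a' * p.1 + b' * p.2 + c') : mplane R) @^-1` A).
Proof.
by move=> mA; rewrite -[X in measurable X]setTI; apply: measurable_affine_map.
Qed.

(** The map preserves each vertical line and acts there as an affine map with
slope d. *)
Lemma area_shear_y (c d f : R) (A : set (mplane R)) : d != 0 -> measurable A ->
  (`|d|%:E *
   area ((fun p : mplane R => (p.1, c * p.1 + d * p.2 + f)%R : mplane R) @^-1` A)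
   = area A)%E.
Proof.
move=> d0 mA; rewrite /area /product_measure1.
rewrite -ge0_integralZl//; first last.
- apply: measurable_fun_xsection.
  have := @measurable_preimage_affine 1 0 0 c d f _ mA.
  by under eq_fun do rewrite mul1r mul0r !addr0.
apply: eq_integral => x _ /=.
rewrite -[RHS](@lebesgue_measure_affine d (c * x + f)%R)//; last first.
  exact: measurable_xsection.
congr (_ * mu _)%E; apply/seteqP; split => y; rewrite /xsection/= !inE/=.
  by rewrite addrCA addrA.
by rewrite addrCA addrA.
Qed.

(** As for vertical shears, once Tonelli's theorem has turned the area into an
integral over the horizontal sections. *)
Lemma area_shear_x (a b e : R) (A : set (mplane R)) : a != 0 -> measurable A ->
  (`|a|%:E *
   area ((fun p : mplane R => (a * p.1 + b * p.2 + e, p.2)%R : mplane R) @^-1` A)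
   = area A)%E.
Proof.
move=> a0 mA.
have areaE B : measurable B -> area B = (\int[mu]_y mu (ysection B y))%E.
  move=> mB; have := indic_fubini_tonelli mu mu mB.
  by rewrite indic_fubini_tonelli_FE// indic_fubini_tonelli_GE.
have mA' : measurable
    ((fun p : mplane R => (a * p.1 + b * p.2 + e, p.2)%R : mplane R) @^-1` A).
  have := @measurable_preimage_affine a b e 0 1 0 _ mA.
  by under eq_fun do rewrite mul1r mul0r add0r !addr0.
rewrite !areaE// -ge0_integralZl//; last exact: measurable_fun_ysection.
apply: eq_integral => y _ /=.
rewrite -[RHS](@lebesgue_measure_affine a (b * y + e)%R)//; last first.
  exact: measurable_ysection.
congr (_ * mu _)%E; apply/seteqP; split => x; rewrite /ysection/= !inE/=.
  by rewrite addrA.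
by rewrite addrA.
Qed.

(** With a pivot the map is a horizontal shear of factor a followed by a vertical
one of factor D / a, where D is the determinant. *)
Lemma area_affine_pivot (a b e c d f : R) (A : set (mplane R)) :
  a != 0 -> a * d - b * c != 0 -> measurable A ->
  (`|a * d - b * c|%:E *
   area ((fun p : mplane R =>
           (a * p.1 + b * p.2 + e, c * p.1 + d * p.2 + f)%R : mplane R) @^-1` A)
   = area A)%E.
Proof.
move=> a0 D0 mA; set D := a * d - b * c.
have Da0 : D / a != 0 by rewrite mulf_neq0// invr_neq0.
rewrite -(@area_shear_y (c / a) (D / a) (f - c * e / a) A Da0 mA).
have mA' : measurable
    ((fun p : mplane R =>
        (p.1, c / a * p.1 + D / a * p.2 + (f - c * e / a))%R : mplane R) @^-1` A).
  have := @measurable_preimage_affine 1 0 0 (c / a) (D / a) (f - c * e / a) _ mA.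
  by under eq_fun do rewrite mul1r mul0r !addr0.
rewrite -(area_shear_x b e a0 mA').
rewrite muleA -EFinM -normrM mulrAC -mulrA divff// mulr1; congr (_ * area _)%E.
apply/seteqP; split => -[x y] /=; congr (A (_, _)); rewrite /D; field; exact: a0.
Qed.

Lemma area_affine (a b e c d f : R) (A : set (mplane R)) :
  a * d - b * c != 0 -> measurable A ->
  (`|a * d - b * c|%:E *
   area ((fun p : mplane R =>
           (a * p.1 + b * p.2 + e, c * p.1 + d * p.2 + f)%R : mplane R) @^-1` A)
   = area A)%E.
Proof.
move=> D0 mA; have [a0|a0] := eqVneq a 0; last exact: area_affine_pivot.
rewrite a0 mul0r sub0r in D0 *.
(* Composing with (x, y) |-> (x, x + y) produces the pivot - b. *)
have b0 : - b != 0.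
  by apply: contra_neq D0 => /eqP; rewrite oppr_eq0 => /eqP->; rewrite mul0r oppr0.
have E : - b * d - b * (c - d) = - (b * c) by ring.
have := @area_affine_pivot (- b) b e (c - d) d f A b0.
rewrite E => /(_ D0 mA) <-.
rewrite -(@area_shear_y 1 1 0 ((fun p : mplane R =>
    (- b * p.1 + b * p.2 + e, (c - d) * p.1 + d * p.2 + f)%R : mplane R) @^-1` A))
  ?oner_neq0//; last first.
  exact: measurable_preimage_affine.
rewrite normr1 mul1e; congr (_ * area _)%E.
by apply/seteqP; split => -[x y] /=; congr (A (_, _)); ring.
Qed.

End affine_measure.

(** * The unit triangle and the unit disc *)

Section planar_areas.
Context {R : realType}.
Local Notation mu := (@lebesgue_measure R).

(** The derivative is asked for inside the interval only, since asin, which occurs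
in the antiderivative for the disc, has none at the ends. Continuity there is
therefore a separate hypothesis. *)
Lemma area_sections (a b : R) (f F : R -> R) (A : set (mplane R)) :
  a < b ->
  {within `[a, b], continuous f} -> {within `[a, b], continuous F} ->
  (forall x : R, x \in `]a, b[ -> is_derive x 1 F (f x)) ->
  (forall x : R, x \in `]a, b[ -> mu (xsection A x) = (f x)%:E) ->
  (forall x, x \notin `]a, b[ -> xsection A x = set0) ->
  area A = (F b - F a)%:E.
Proof.
move=> ab cf cF dF secA sec0.
have [cFi cFa cFb] := (continuous_within_itvP F ab).1 cF.
have -> : area A = (\int[mu]_(x in `]a, b[) (f x)%:E)%E.
  rewrite [RHS]integral_mkcond /area /product_measure1.
  apply: eq_integral => x _ /=; rewrite /patch.
  case: ifPn; rewrite ?inE ?notin_setE /= => xab.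
    by rewrite secA.
  by rewrite sec0 ?measure0//; apply/negP.
rewrite -(@integral_itv_bndoo _ a b _ true false).
  rewrite (@continuous_FTC2 _ f F)//.
  - split => // x xab; by have [] := dF _ xab.
  - by move=> x xab; rewrite derive1E; by have [_ ->] := dF _ xab.
apply/measurable_EFinP; apply: (@measurable_funS _ _ _ _ `[a, b]%classic) => //.
  by apply: subset_itv_oo_cc.
by apply: subspace_continuous_measurable_fun.
Qed.

(** One side is included and the other two are not, so that the triangles over
consecutive sides of a polygon are disjoint. *)
Definition unit_triangle : set (mplane R) :=
  [set p | [/\ 0 < p.1, 0 <= p.2 & p.1 + p.2 < 1]].

Lemma area_unit_triangle : area unit_triangle = (2^-1)%:E.
Proof.
have -> : 2^-1 = (1 - 1 ^+ 2 / 2) - (0 - 0 ^+ 2 / 2) :> R by field.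
apply: (@area_sections 0 1 (fun x => 1 - x) (fun x => x - x ^+ 2 / 2)) => //.
- apply: continuous_subspaceT => x; apply: cvgB; [exact: cvg_cst|exact: cvg_id].
- apply: continuous_subspaceT => x; apply: cvgB; first exact: cvg_id.
  by apply: cvgMl; exact: exprn_continuous.
- move=> x _; apply: is_derive_eq.
  by rewrite /GRing.scale/=; field.
- move=> x /[!in_itv]/= /andP[x0 x1].
  rewrite (_ : xsection _ _ = `[0, (1 - x)[%classic).
    by rewrite lebesgue_measure_itv/= lte_fin subr_gt0 x1 oppr0 adde0.
  apply/seteqP; split => y; rewrite /xsection/= inE in_itv/=.
    by move=> [/= _ -> h]/=; rewrite ltrBrDl.
  by move=> /andP[y0 h]; split => //=; rewrite -ltrBrDl.
- move=> x; rewrite in_itv/= negb_and -!leNgt => x01.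
  apply/seteqP; split => // y; rewrite /xsection/= inE /= => -[/= x0 y0 xy].
  by case/orP: x01; lra.
Qed.

(** At the ends, where the derivative of asin is infinite, continuity holds because
asin is the inverse of a continuous injection of a compact interval. *)
Lemma asin_within_continuous : {within `[-1, 1], continuous (@asin R)}.
Proof.
have := @segment_can_le_continuous R (- (pi / 2)) (pi / 2) (@sin R) (@asin R).
rewrite sinN sin_pihalf; apply.
- by have := pi_gt0 R; lra.
- by apply: continuous_subspaceT; exact: continuous_sin.
- exact: sinK.
Qed.

Definition unit_disc : set (mplane R) := [set p | p.1 ^+ 2 + p.2 ^+ 2 < 1].

(** The section at x has length 2 sqrt (1 - x ^ 2), the derivative of
x sqrt (1 - x ^ 2) + asin x. *)
Lemma area_unit_disc : area unit_disc = pi%:E.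
Proof.
have cs : {within `[-1, 1], continuous (fun x : R => Num.sqrt (1 - x ^+ 2))}.
  apply: continuous_subspaceT => x.
  apply: (@continuous_comp _ _ _ (fun x : R => 1 - x ^+ 2) Num.sqrt).
    by apply: cvgB; [exact: cvg_cst|exact: exprn_continuous].
  exact: sqrt_continuous.
pose F (x : R) := x * Num.sqrt (1 - x ^+ 2) + asin x.
have -> : pi = F 1 - F (-1).
  rewrite /F sqrrN expr1n subrr sqrtr0 !mulr0 !add0r.
  have -> : asin (1 : R) = pi / 2.
    by rewrite -[in LHS]sin_pihalf sinK// in_itv/= lexx andbT; have := pi_gt0 R; lra.
  have -> : asin (-1 : R) = - (pi / 2).
    by rewrite -[in LHS]sin_pihalf -sinN sinK// in_itv/= lexx; have := pi_gt0 R; lra.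
  by field.
apply: (@area_sections (-1) 1 (fun x => 2 * Num.sqrt (1 - x ^+ 2)) F).
- by lra.
- by move=> x; apply: cvgMr; exact: cs.
- move=> x; apply: cvgD; last exact: asin_within_continuous.
  apply: cvgM; last exact: cs.
  by apply: continuous_subspaceT => y; exact: cvg_id.
- move=> x /[!in_itv]/= /andP[x0 x1].
  have x2 : 0 < 1 - x ^+ 2 by nra.
  have s0 : Num.sqrt (1 - x ^+ 2) != 0 by rewrite gt_eqF// sqrtr_gt0.
  have dq : is_derive x 1 (fun x : R => 1 - x ^+ 2) (- (2 * x)).
    by apply: is_derive_eq; rewrite /GRing.scale/=; ring.
  have ds := @is_derive1_comp _ Num.sqrt _ x _ _ (is_derive1_sqrt x2) dq.
  have da : is_derive x 1 (@asin R) (Num.sqrt (1 - x ^+ 2))^-1.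
    by apply: is_derive1_asin; rewrite x0.
  have dx : is_derive x 1 (@idfun R) 1 by exact: is_derive_id.
  have [dF vF] := is_deriveD (is_deriveM dx ds) da.
  apply: DeriveDef; first exact: dF.
  rewrite [LHS]vF /GRing.scale/=.
  have := sqr_sqrtr (ltW x2).
  move: (Num.sqrt _) s0 => t t0 t2.
  have -> : x * ((2 * t)^-1 * - (2 * x)) + t * 1 + t^-1 =
            (t ^+ 2 + (1 - x ^+ 2)) / t by field.
  by rewrite -t2; field.
- move=> x /[!in_itv]/= /andP[x0 x1].
  have x2 : 0 < 1 - x ^+ 2 by nra.
  rewrite (_ : xsection _ _ =
    `](- Num.sqrt (1 - x ^+ 2)), (Num.sqrt (1 - x ^+ 2))[%classic).
    have s0 : 0 < Num.sqrt (1 - x ^+ 2) by rewrite sqrtr_gt0.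
    rewrite lebesgue_measure_itv/= lte_fin ifT; last by lra.
    by rewrite -EFinB opprK; congr EFin; ring.
  apply/seteqP; split => y; rewrite /xsection/= inE in_itv/= -ltr_norml;
    rewrite -[`|y|]sqrtr_sqr ltr_sqrt// /unit_disc/=; lra.
- move=> x; rewrite in_itv/= negb_and -!leNgt => x01.
  apply/seteqP; split => // y; rewrite /xsection/= inE /unit_disc /= => h.
  by case/orP: x01; nra.
Qed.

End planar_areas.

(** * Open convex sets of the plane and their boundaries *)

Section planar_convexity.
Context {R : realType}.
Implicit Types (D : set (R * R)) (p q x y : R * R).

(** Membership in the balls of the product R * R, in coordinates. *)
Definition sup_close e p q := `|p.1 - q.1| < e /\ `|p.2 - q.2| < e.

Lemma ball_close e p q : ball p e q <-> sup_close e p q.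
Proof. by rewrite /ball/= /prod_ball /= -!ball_normE. Qed.

Lemma open_close D p : open D -> D p ->
  exists2 e, 0 < e & forall q, sup_close e p q -> D q.
Proof.
rewrite openE => /[apply] /nbhs_ballP[e e0 h]; exists e => // q pq; exact: h.
Qed.

Lemma closure_close D p :
  closure D p <-> forall e, 0 < e -> exists2 q, D q & sup_close e p q.
Proof.
split=> [cDp e e0|h U /nbhs_ballP[e e0 eU]].
  have [|q [Dq /ball_close pq]] := cDp (ball p e); first exact: nbhsx_ballx.
  by exists q.
have [q Dq /ball_close pq] := h _ e0; exists q; split => //; exact: eU.
Qed.

Lemma bounded_abs D :
  bounded_set D <-> exists M, forall p, D p -> `|p.1| <= M /\ `|p.2| <= M.
Proof.
split=> [[M [_ hM]]|[M hM]].
  exists (M + 1) => p Dp; have := hM (M + 1); rewrite ltrDl ltr01 => /(_ isT p Dp).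
  by rewrite /Num.norm/= ge_max => /andP[].
exists M; split; first exact: num_real.
move=> M' MM' p /hM[p1 p2]; rewrite /Num.norm /= ge_max.
by rewrite (le_trans p1 (ltW MM')) (le_trans p2 (ltW MM')).
Qed.

(** Convexity in terms of the points of segments by which the sides of polygons are
given. *)
Definition seg_convex D :=
  forall p q s, 0 <= s <= 1 -> D p -> D q -> D (segment_point p q s).

Lemma convex_setP D :
  convex_set (D : set (convex_lmodType (R * R)%type)) <-> seg_convex D.
Proof.
split => [cD p q s /andP[s0 s1] Dp Dq|cD p q l].
  have := cD q p (Itv01 s0 s1); rewrite !inE => /(_ Dq Dp).
  by congr D; rewrite /segment_point [LHS]addrC.
rewrite !inE => Dp Dq.
have := cD q p l%:num; rewrite ge0 le1 => /(_ isT Dq Dp).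
by congr D; rewrite /segment_point [RHS]addrC.
Qed.

Lemma segment_pointE p q s :
  segment_point p q s = (p.1 + s * (q.1 - p.1), p.2 + s * (q.2 - p.2)).
Proof. by rewrite /segment_point; congr pair; ring. Qed.

(** Replace y by a point y' of D so close to it that the resulting shift of the
first endpoint stays in D. *)
Lemma open_segment_closure D p y t : open D -> seg_convex D -> D p -> closure D y ->
  0 <= t < 1 -> D (segment_point p y t).
Proof.
move=> oD cD Dp /closure_close cy /andP[t0 t1].
have [e e0 he] := open_close oD Dp.
have t1' : 0 < 1 - t by rewrite subr_gt0.
have [y' Dy' [y1 y2]] := cy _ (mulr_gt0 e0 t1').
pose p' := (p.1 + t / (1 - t) * (y.1 - y'.1), p.2 + t / (1 - t) * (y.2 - y'.2)).
have aux (a b b' : R) : `|b - b'| < e * (1 - t) ->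
    `|a - (a + t / (1 - t) * (b - b'))| < e.
  move=> h; rewrite opprD addrA subrr sub0r normrN normrM ger0_norm; last first.
    by rewrite divr_ge0// ltW.
  rewrite mulrAC ltr_pdivrMr//; apply: le_lt_trans h.
  by rewrite ler_piMl// ltW.
have Dp' : D p' by apply: he; split; exact: aux.
have := cD p' y' t; rewrite t0 ltW// => /(_ isT Dp' Dy').
by congr D; rewrite /segment_point /p'/=; congr pair; field; rewrite gt_eqF.
Qed.

Lemma open_boundary D p : open D -> boundary D p <-> closure D p /\ ~ D p.
Proof. by move=> /interior_id oD; rewrite /boundary oD. Qed.

(** The exit parameter is the supremum of the parameters of points of D; it exists
because D is bounded, and it does not belong to D because D is open. *)
Lemma ray_exit D x v : open D -> bounded_set D -> D x -> v != 0 ->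
  exists2 t, 0 < t & boundary D (x + t *: v).
Proof.
move=> oD /bounded_abs[M hM] Dx v0.
pose T := [set t : R | 0 <= t /\ D (x + t *: v)].
have T0 : T 0 by split => //; rewrite scale0r addr0.
have ubT : has_ubound T.
  have [v1|v1] := eqVneq v.1 0.
    have v2 : v.2 != 0.
      by apply: contra_neq v0 => v2; rewrite [v]surjective_pairing v1 v2.
    exists ((M + `|x.2|) / `|v.2|) => t [t0 /hM[_ h]].
    rewrite ler_pdivlMr ?normr_gt0// -[t]ger0_norm// -normrM.
    have -> : t * v.2 = (x + t *: v).2 - x.2 by rewrite /= addrAC subrr add0r.
    by rewrite (le_trans (ler_normB _ _))// lerD2r.
  exists ((M + `|x.1|) / `|v.1|) => t [t0 /hM[h _]].
  rewrite ler_pdivlMr ?normr_gt0// -[t]ger0_norm// -normrM.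
  have -> : t * v.1 = (x + t *: v).1 - x.1 by rewrite /= addrAC subrr add0r.
  by rewrite (le_trans (ler_normB _ _))// lerD2r.
have hsT : has_sup T by split => //; exists 0.
(* A Lipschitz constant of t |-> x + t v for the sup norm; the term 1 makes it
   a positive divisor. *)
pose m := 1 + `|v.1| + `|v.2|.
have m0 : 0 < m by rewrite /m -addrA ltr_pwDl.
have near_ray (e s t : R) : `|s - t| < e / m -> sup_close e (x + s *: v) (x + t *: v).
  move=> st; have st' : `|s - t| * m < e by rewrite -ltr_pdivlMr.
  split => /=; rewrite opprD addrACA subrr add0r -mulrBl normrM; apply: le_lt_trans st';
    by rewrite ler_wpM2l// /m; have := normr_ge0 v.1; have := normr_ge0 v.2; lra.
have nsup t : D (x + t *: v) -> 0 <= t -> t < sup T.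
  move=> Dt t0; have [e e0 he] := open_close oD Dt.
  apply: (@lt_le_trans _ _ (t + e / m / 2)).
    by rewrite ltrDl divr_gt0// divr_gt0.
  apply: (ub_le_sup ubT); split; first by rewrite addr_ge0// divr_ge0// divr_ge0// ltW.
  apply: he; apply: near_ray; rewrite opprD addrA subrr sub0r normrN.
  have em : 0 < e / m by rewrite divr_gt0.
  by rewrite gtr0_norm; lra.
exists (sup T); first by apply: nsup => //; case: T0.
apply/open_boundary => //; split.
  apply/closure_close => e e0.
  have em : 0 < e / m by rewrite divr_gt0.
  have [t Tt lt_t] := sup_adherent em hsT.
  exists (x + t *: v); first by case: Tt.
  apply: near_ray; rewrite ger0_norm ?subr_ge0; first by rewrite ltrBlDl -ltrBlDr.
  exact: ub_le_sup.
by move=> /nsup; rewrite ltxx; have /(ub_le_sup ubT) -> := T0; move=> /(_ isT).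
Qed.

(** D1 avoids the common boundary, so by connectedness it lies inside D2 or outside
its closure. In the second case draw the ray from a point p of D2 through a
point x1 of D1. It leaves D1 at a point of the common boundary, and x1, which is
strictly between that point and p, belongs to D2 by convexity. The inclusion of
D2 in D1 needs connectedness only, because D1 now meets D2. *)
Lemma bounded_region_unique D1 D2 :
  open D1 -> connected D1 -> bounded_set D1 -> D1 !=set0 ->
  open D2 -> connected D2 -> seg_convex D2 ->
  boundary D1 = boundary D2 -> D1 = D2.
Proof.
move=> oD1 kD1 bD1 [x1 D1x1] oD2 kD2 cD2 bE.
have sep (D : set (R * R)) : open D -> separated D (~` closure D).
  move=> oD; split.
    by apply/seteqP; split => p // -[Dp].
  apply/seteqP; split => p // -[Dp cp].
  have [q [nq Dq]] := cp D (open_nbhs_nbhs (conj oD Dp)).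
  by apply: nq; exact: subset_closure.
have cut (D E : set (R * R)) : open D -> open E -> boundary D = boundary E ->
    D `<=` E `|` ~` closure E.
  move=> oD oE bDE p Dp; have [Ep|nEp] := pselect (E p); [by left|right => cEp].
  have : boundary E p by apply/open_boundary.
  by rewrite -bDE => /open_boundary[].
have D12 : D1 `<=` D2.
  have [//|D1out] := connected_subset (sep _ oD2) (cut _ _ oD1 oD2 bE) kD1.
  have nx1 : ~ closure D2 x1 := D1out _ D1x1.
  have [p D2p] : D2 !=set0.
    have [|t _] := @ray_exit _ x1 (1, 0) oD1 bD1 D1x1.
      by apply/eqP => -[/eqP]; rewrite oner_eq0.
    rewrite bE => -[/closure_close/(_ 1 ltr01)[q D2q _] _]; by exists q.
  have xp : x1 - p != 0.
    rewrite subr_eq0; apply/eqP => x1p; apply: nx1.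
    by rewrite x1p; exact: subset_closure.
  have [t t0] := ray_exit oD1 bD1 D1x1 xp.
  rewrite bE => -[cz _]; exfalso; apply: nx1; apply: subset_closure.
  have t1 : 0 < 1 + t by lra.
  have := @open_segment_closure _ p _ (1 + t)^-1 oD2 cD2 D2p cz.
  rewrite invr_ge0 ltW// invf_lt1// ltrDl t0 => /(_ isT).
  rewrite segment_pointE/=; congr D2; rewrite [RHS]surjective_pairing.
  by congr pair; rewrite /GRing.scale/=; field; rewrite gt_eqF.
apply/seteqP; split => //.
have [//|D2out] := connected_subset (sep _ oD1) (cut _ _ oD2 oD1 (esym bE)) kD2.
have nx1 : ~ closure D1 x1 := D2out _ (D12 _ D1x1).
by case: nx1; exact: subset_closure.
Qed.

Lemma continuous_pair (T : topologicalType) (f g : T -> R) :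
  continuous f -> continuous g -> continuous (fun t => (f t, g t)).
Proof. by move=> cf cg t; apply: (cvg_pair (cf t) (cg t)). Qed.

Lemma segment_point_continuous p q : continuous (segment_point p q).
Proof.
apply: continuous_pair => s; apply: cvgD; apply: cvgMl.
- by apply: cvgB; [exact: cvg_cst|exact: cvg_id].
- exact: cvg_id.
- by apply: cvgB; [exact: cvg_cst|exact: cvg_id].
- exact: cvg_id.
Qed.

Lemma seg_convex_connected D : seg_convex D -> connected D.
Proof.
move=> cD; have [->|/set0P[p Dp]] := eqVneq D set0; first exact: connected0.
have -> : D = \bigcup_(q in D) (segment_point p q @` `[0, 1]).
  apply/seteqP; split => [q Dq|q [q' Dq' [s s01 <-]]].
    exists q => //; exists 1; rewrite /= ?in_itv/= ?lexx ?ler01//.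
    by rewrite segment_pointE !mul1r ![_ + (_ - _)]addrC !subrK -surjective_pairing.
  by apply: cD => //; move: s01; rewrite /= in_itv.
apply: bigcup_connected.
  exists p => q Dq; exists 0; rewrite /= ?in_itv/= ?lexx ?ler01//.
  by rewrite segment_pointE !mul0r !addr0 -surjective_pairing.
move=> q Dq; apply: connected_continuous_connected; first exact: segment_connected.
apply: continuous_subspaceT; exact: segment_point_continuous.
Qed.

End planar_convexity.

(** * Euclidean distance and arc length *)

Section curves.
Context {R : realType}.
Implicit Types (C : R -> R * R) (D : set (R * R)) (p q x y : R * R).

Lemma eucl_dist_ge0 p q : 0 <= edist p q.
Proof. exact: sqrtr_ge0. Qed.

Lemma eucl_distC p q : edist p q = edist q p.
Proof. by rewrite /edist -!(sqrrN (q.1 - _)) -!(sqrrN (q.2 - _)) !opprB. Qed.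

(** By the Cauchy-Schwarz inequality, which is the sign of a squared determinant. *)
Lemma eucl_dist_triangle p q x : edist p x <= edist p q + edist q x.
Proof.
rewrite /edist.
have -> : p.1 - x.1 = (p.1 - q.1) + (q.1 - x.1) by ring.
have -> : p.2 - x.2 = (p.2 - q.2) + (q.2 - x.2) by ring.
move: (p.1 - q.1) (p.2 - q.2) (q.1 - x.1) (q.2 - x.2) => a b c d.
set u := Num.sqrt (a ^+ 2 + _); set v := Num.sqrt (c ^+ 2 + _).
have u0 : 0 <= u by exact: sqrtr_ge0.
have v0 : 0 <= v by exact: sqrtr_ge0.
have uu : u ^+ 2 = a ^+ 2 + b ^+ 2 by rewrite sqr_sqrtr// addr_ge0// sqr_ge0.
have vv : v ^+ 2 = c ^+ 2 + d ^+ 2 by rewrite sqr_sqrtr// addr_ge0// sqr_ge0.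
have cs : a * c + b * d <= u * v.
  rewrite (le_trans (ler_norm _))// -(ger0_norm (mulr_ge0 u0 v0)).
  rewrite -ler_sqr ?nnegrE// !real_normK ?num_real// exprMn uu vv.
  have := sqr_ge0 (a * d - b * c); nra.
rewrite -[leRHS]ger0_norm ?addr_ge0// -[leRHS]sqrtr_sqr ler_wsqrtr//.
have -> : (u + v) ^+ 2 = a ^+ 2 + b ^+ 2 + (c ^+ 2 + d ^+ 2) + 2 * (u * v).
  by rewrite -uu -vv; ring.
nra.
Qed.

Lemma eucl_dist_segment p q s t :
  edist (segment_point p q s) (segment_point p q t) = `|s - t| * edist p q.
Proof.
rewrite /edist !segment_pointE/= -[`|s - t|]sqrtr_sqr -sqrtrM ?sqr_ge0//.
by congr Num.sqrt; ring.
Qed.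

Lemma eucl_dist_eq0 p q : edist p q = 0 -> p = q.
Proof.
move/eqP; rewrite sqrtr_eq0 => h.
have h1 : (p.1 - q.1) ^+ 2 = 0.
  by apply/eqP; rewrite eq_le sqr_ge0 andbT (le_trans _ h)// lerDl sqr_ge0.
have h2 : (p.2 - q.2) ^+ 2 = 0.
  by apply/eqP; rewrite eq_le sqr_ge0 andbT (le_trans _ h)// lerDr sqr_ge0.
move/eqP: h1; rewrite sqrf_eq0 subr_eq0 => /eqP h1.
move/eqP: h2; rewrite sqrf_eq0 subr_eq0 => /eqP h2.
by rewrite [p]surjective_pairing h1 h2 -surjective_pairing.
Qed.

Lemma itv_partition_nondecreasing (s : seq R) i j : itv_partition 0 1 s ->
  (i <= j <= size s)%N -> nth 1 (0 :: s) i <= nth 1 (0 :: s) j.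
Proof.
move=> [sP _] /andP[ij js].
apply: (@sorted_leq_nth _ (@Order.le _ R)) => //=.
- exact: le_trans.
- by apply: sub_path sP => a b; exact: ltW.
- by rewrite inE ltnS (leq_trans ij).
Qed.

Lemma itv_partition_last (s : seq R) :
  itv_partition 0 1 s -> nth 1 (0 :: s) (size s) = 1.
Proof.
by move=> [_ /eqP]; rewrite (last_nth 1).
Qed.

Lemma itv_partition_itv (s : seq R) i : itv_partition 0 1 s -> (i <= size s)%N ->
  nth 1 (0 :: s) i \in `[0, 1].
Proof.
move=> sP si; rewrite in_itv/=; apply/andP; split.
  by apply: (itv_partition_nondecreasing (i := 0) sP); rewrite leq0n.
rewrite -[leRHS](itv_partition_last sP); apply: itv_partition_nondecreasing => //.
by rewrite si leqnn.
Qed.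

Lemma eq_arc_length C C' : {in `[0, 1], C =1 C'} -> arc_length C = arc_length C'.
Proof.
move=> CC'; rewrite /arc_length; congr ereal_sup.
have aux (C1 C2 : R -> R * R) : {in `[0, 1], C1 =1 C2} ->
    [set (inscribed_length C1 s)%:E | s in itv_partition 0 1] `<=`
    [set (inscribed_length C2 s)%:E | s in itv_partition 0 1].
  move=> C12 _ [s sP <-]; exists s => //; congr EFin; rewrite /inscribed_length.
  rewrite !big_mkord; apply: eq_bigr => k _ /=.
  have h j : (j <= size s)%N -> C2 (nth 1 (0 :: s) j) = C1 (nth 1 (0 :: s) j).
    by move=> js; rewrite C12//; exact: itv_partition_itv.
  by congr edist; [exact: (h k.+1)|exact/h/ltnW].
by apply/seteqP; split; apply: aux => // t t01; rewrite CC'.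
Qed.

(** Over a partition the increments of L telescope. *)
Lemma arc_length_le C (L : R -> R) :
  (forall s t, 0 <= s -> s <= t -> t <= 1 -> edist (C t) (C s) <= L t - L s) ->
  (arc_length C <= (L 1 - L 0)%:E)%E.
Proof.
move=> CL; apply: ge_ereal_sup => _ [s sP <-]; rewrite lee_fin /inscribed_length.
have -> : L 1 - L 0 =
    \sum_(0 <= k < size s) (L (nth 1 (0 :: s) k.+1) - L (nth 1 (0 :: s) k)).
  by rewrite (telescope_sumr (fun k => L (nth 1 (0 :: s) k)))// (itv_partition_last sP).
rewrite !big_nat; apply: ler_sum => k /andP[_ ks]; apply: CL.
- by have := itv_partition_itv sP (ltnW ks); rewrite in_itv => /andP[].
- by apply: itv_partition_nondecreasing => //; rewrite leqnSn.
- by have := itv_partition_itv sP ks; rewrite in_itv => /andP[].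
Qed.

Lemma arc_length_uniform C (m : nat) : (0 < m)%N ->
  ((\sum_(0 <= k < m) edist (C (k.+1%:R / m%:R)) (C (k%:R / m%:R)))%:E
   <= arc_length C)%E.
Proof.
move=> m0; pose s : seq R := mkseq (fun k => k.+1%:R / m%:R) m.
have sE k : (k <= m)%N -> nth 1 (0 :: s) k = k%:R / m%:R.
  by case: k => [|k] km /=; rewrite ?mul0r// nth_mkseq.
apply: le_ereal_sup_tmp => /=.
exists (inscribed_length C s)%:E; last first.
  rewrite lee_fin /inscribed_length size_mkseq !big_nat.
  apply: ler_sum => k /andP[_ km] /=.
  by rewrite -[nth 1 s k]/(nth 1 (0 :: s) k.+1) (sE k.+1)// (sE k)// ltnW.
exists s => //; split.
  apply/(pathP 1) => k; rewrite size_mkseq => km.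
  rewrite (sE _ (ltnW km)) -[nth 1 s k]/(nth 1 (0 :: s) k.+1) (sE _ km).
  by rewrite ltr_pM2r ?invr_gt0 ?ltr0n// ltr_nat.
rewrite (last_nth 1) size_mkseq sE// divff// pnatr_eq0 -lt0n//.
Qed.

End curves.

(** * Similarities and the bounded region of a curve *)

Section similarities.
Context {R : realType}.
Implicit Types (C : R -> R * R) (D : set (R * R)) (p q d x y : R * R) (c : R).

(** A homothety followed by a translation: rotations are never needed, since a
rescaled curve may keep its direction. *)
Definition sim c d p : R * R := (c * p.1 + d.1, c * p.2 + d.2).

Definition sim_inv c d : R * R -> R * R := sim c^-1 (- d.1 / c, - d.2 / c).

Lemma simK c d : c != 0 -> cancel (sim c d) (sim_inv c d).
Proof.
by move=> c0 [x y]; rewrite /sim_inv /sim/=; congr pair; field.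
Qed.

Lemma sim_invK c d : c != 0 -> cancel (sim_inv c d) (sim c d).
Proof.
by move=> c0 [x y]; rewrite /sim_inv /sim/=; congr pair; field.
Qed.

Lemma sim_image c d D : c != 0 -> sim c d @` D = sim_inv c d @^-1` D.
Proof.
move=> c0; apply/seteqP; split => [_ [p Dp <-]|p Dp] /=; first by rewrite simK.
by exists (sim_inv c d p) => //; rewrite sim_invK.
Qed.

Lemma continuous_sim c d : continuous (sim c d).
Proof.
have aff (f : R * R -> R) (a b : R) : continuous f -> continuous (fun p => a * f p + b).
  by move=> cf p; apply: cvgD; [apply: cvgMr; exact: cf|exact: cvg_cst].
by apply: continuous_pair; apply: aff => p; [exact: cvg_fst|exact: cvg_snd].
Qed.

Lemma continuous_sim_inv c d : continuous (sim_inv c d).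
Proof. exact: continuous_sim. Qed.

Lemma sim_segment c d p q s :
  sim c d (segment_point p q s) = segment_point (sim c d p) (sim c d q) s.
Proof. by rewrite /sim /segment_point/=; congr pair; ring. Qed.

Lemma sim_edist c d p q : 0 <= c -> edist (sim c d p) (sim c d q) = c * edist p q.
Proof.
move=> c0; rewrite /edist /sim/= -[c in RHS]ger0_norm// -[`|c|]sqrtr_sqr.
rewrite -sqrtrM ?sqr_ge0//.
by congr Num.sqrt; ring.
Qed.

Lemma open_sim c d D : c != 0 -> open D -> open (sim c d @` D).
Proof.
move=> c0 oD; rewrite sim_image//.
by apply: open_comp => // p _; exact: continuous_sim_inv.
Qed.

Lemma closed_sim c d D : c != 0 -> closed D -> closed (sim c d @` D).
Proof.
move=> c0 oD; rewrite sim_image//.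
by apply: closed_comp => // p _; exact: continuous_sim_inv.
Qed.

Lemma closure_sim c d D : c != 0 -> closure (sim c d @` D) = sim c d @` closure D.
Proof.
move=> c0.
have sub c' d' E : c' != 0 -> closure (sim c' d' @` E) `<=` sim c' d' @` closure E.
  move=> c'0; have /closure_id -> := @closed_sim c' d' _ c'0 (@closed_closure _ E).
  by apply: closure_subset; apply: image_subset; exact: subset_closure.
apply/seteqP; split; first exact: sub.
(* The reverse inclusion is the first one for the inverse similarity. *)
move=> _ [p cp <-].
rewrite -[D](_ : sim_inv c d @` (sim c d @` D) = D) in cp; last first.
  rewrite image_comp -[RHS]image_id; apply: eq_imagel => q _; exact: simK.
have [|q cq qp] := sub _ _ _ _ _ cp; first by rewrite invr_eq0.
by rewrite -qp -/(sim_inv c d q) sim_invK.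
Qed.

Lemma boundary_sim c d D : c != 0 -> open D ->
  boundary (sim c d @` D) = sim c d @` boundary D.
Proof.
move=> c0 oD; rewrite /boundary closure_sim//.
have /interior_id -> := @open_sim c d _ c0 oD; have /interior_id -> := oD.
by rewrite !sim_image// preimage_setD.
Qed.

Lemma bounded_sim c d D : bounded_set D -> bounded_set (sim c d @` D).
Proof.
move=> /bounded_abs[M hM]; apply/bounded_abs.
exists (`|c| * M + (`|d.1| + `|d.2|)) => _ [p Dp <-].
have [p1 p2] := hM _ Dp.
rewrite /sim/=; split; rewrite (le_trans (ler_normD _ _))// lerD// ?lerDl ?lerDr//;
  by rewrite normrM ler_wpM2l.
Qed.

Lemma seg_convex_sim c d D : seg_convex D -> seg_convex (sim c d @` D).
Proof.
move=> cD _ _ s s01 [p Dp <-] [q Dq <-]; exists (segment_point p q s); first exact: cD.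
exact: sim_segment.
Qed.

Lemma curve_image_sim c d C : curve_image (sim c d \o C) = sim c d @` curve_image C.
Proof. by rewrite /curve_image image_comp. Qed.

Lemma is_bounded_region_sim c d C D : c != 0 ->
  is_bounded_region C D -> is_bounded_region (sim c d \o C) (sim c d @` D).
Proof.
move=> c0 [oD kD bD bE]; split.
- exact: open_sim.
- apply: connected_continuous_connected => //; apply: continuous_subspaceT.
  exact: continuous_sim.
- exact: bounded_sim.
- by rewrite boundary_sim// bE curve_image_sim.
Qed.

Lemma simple_closed_sim c d C :
  c != 0 -> simple_closed C -> simple_closed (sim c d \o C).
Proof.
move=> c0 [cC CC iC]; split.
- by move=> t; apply: cvg_comp; [exact: cC|exact: continuous_sim].
- by rewrite /= CC.
- move=> s t s01 t01 /(can_inj (simK d c0)); exact: iC.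
Qed.

Lemma inscribed_length_sim c d C s : 0 <= c ->
  inscribed_length (sim c d \o C) s = c * inscribed_length C s.
Proof.
move=> c0; rewrite /inscribed_length mulr_sumr; apply: eq_bigr => k _.
exact: sim_edist.
Qed.

Lemma arc_length_sim c d C (l : R) : 0 <= c ->
  arc_length C = l%:E -> arc_length (sim c d \o C) = (c * l)%:E.
Proof.
move=> c0 Cl; rewrite EFinM -Cl /arc_length -ereal_supZl//; last first.
  apply/set0P; exists (inscribed_length C [:: 1])%:E; exists [:: 1] => //.
  exact: itv_partition1.
congr ereal_sup; apply/seteqP; split.
  move=> _ [s sP <-]; exists (inscribed_length C s)%:E; first by exists s.
  by rewrite inscribed_length_sim// EFinM.
move=> _ [_ [s sP <-] <-]; exists s => //.
by rewrite inscribed_length_sim// EFinM.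
Qed.

Lemma sim_imageE c d D : c != 0 ->
  sim c d @` D = (fun p : mplane R =>
    (c^-1 * p.1 + 0 * p.2 + - d.1 / c,
     0 * p.1 + c^-1 * p.2 + - d.2 / c) : mplane R) @^-1` D.
Proof.
move=> c0; rewrite sim_image//; apply/seteqP; split => p /=; rewrite /sim_inv /sim /=;
  by rewrite !mul0r addr0 add0r.
Qed.

Lemma measurable_sim c d D : c != 0 -> measurable (D : set (mplane R)) ->
  measurable (sim c d @` D : set (mplane R)).
Proof.
by move=> c0 mD; rewrite sim_imageE//; exact: measurable_preimage_affine.
Qed.

Lemma area_sim c d D : c != 0 -> measurable (D : set (mplane R)) ->
  area (sim c d @` D) = ((c ^+ 2)%:E * area D)%E.
Proof.
move=> c0 mD; rewrite sim_imageE//.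
have detE : c^-1 * c^-1 - 0 * 0 = c ^- 2 by field.
have := @area_affine R c^-1 0 (- d.1 / c) 0 c^-1 (- d.2 / c) D; rewrite detE.
have c2 : c ^- 2 != 0 by rewrite invr_eq0 expf_neq0.
move=> /(_ c2 mD) <-.
rewrite muleA -EFinM ger0_norm; last by rewrite invr_ge0 sqr_ge0.
by rewrite divff ?mul1e// expf_neq0.
Qed.

End similarities.

Section regions.
Context {R : realType}.
Implicit Types (C : R -> R * R) (D : set (R * R)) (p q d x y : R * R) (c : R).

Lemma eq_curve_image C C' : {in `[0, 1], C =1 C'} -> curve_image C = curve_image C'.
Proof.
move=> CC'; apply/seteqP; split => _ [t t01 <-]; exists t => //; first by rewrite CC'.
exact: CC'.
Qed.

Lemma eq_region C C' : {in `[0, 1], C =1 C'} -> region C = region C'.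
Proof.
move=> /eq_curve_image CC'; rewrite /region; congr (xget _ _).
by apply/seteqP; split => D [oD kD bD bE]; split => //; rewrite bE CC'.
Qed.

(** A curve with no bounded region gets the empty set, which has area zero. *)
Lemma region_is_bounded_region C :
  area (region C) != 0%E -> is_bounded_region C (region C).
Proof.
rewrite /region; case: xgetP => [D -> //|_]; rewrite /area measure0 eqxx//.
Qed.

Lemma region_eq C D : is_bounded_region C D -> seg_convex D -> region C = D.
Proof.
move=> CD cD; have CR : is_bounded_region C (region C) by exact: xgetI CD.
case: (CD) => oD kD bD bE; case: CR => oR kR bR rE.
apply: bounded_region_unique => //; last by rewrite bE.
have : boundary (region C) (C 0).
  by rewrite rE; exists 0 => //=; rewrite in_itv/= lexx ler01.
by move=> [/closure_close/(_ _ ltr01)[p Rp _] _]; exists p.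
Qed.

End regions.

(** * Circles *)

Section circles.
Context {R : realType}.
Implicit Types (C : R -> R * R) (D : set (R * R)) (p q d x y : R * R) (c : R).

Definition unit_circle : R -> R * R := circle_path (0, 0) 1.

(** Reduces every question about circles to the unit circle. *)
Lemma circle_pathE o r : circle_path o r = sim r o \o unit_circle.
Proof.
by apply/funext => t; rewrite /circle_path /unit_circle /sim /=; congr pair; ring.
Qed.

Lemma chord (a b : R) :
  edist (cos a, sin a) (cos b, sin b) = 2 * `|sin ((a - b) / 2)|.
Proof.
rewrite /edist/= -{1}[2](@ger0_norm R)// -normrM -[RHS]sqrtr_sqr; congr Num.sqrt.
have := cosB a b.
have -> : cos (a - b) = cos (((a - b) / 2) *+ 2) by congr cos; rewrite mulr2n; field.
rewrite cos_mulr2n cos2sin2.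
have := cos2Dsin2 a; have := cos2Dsin2 b.
move: (cos a) (sin a) (cos b) (sin b) (sin ((a - b) / 2)) => x y z w t.
nra.
Qed.

Lemma sin_mean_value (x : R) : 0 < x -> exists2 c, 0 < c < x & sin x = cos c * x.
Proof.
move=> x0.
have [] := @MVT R sin cos 0 x x0.
- by apply: continuous_subspaceT; exact: continuous_sin.
by move=> c; rewrite in_itv/= sin0 !subr0 => ? ?; exists c.
Qed.

Lemma sin_le (x : R) : `|sin x| <= `|x|.
Proof.
wlog x0 : x / 0 < x.
  move=> h; have [x0|x0|<-] := ltrgtP 0 x; first exact: h.
    by rewrite -[leLHS]normrN -sinN -[leRHS]normrN h// oppr_gt0.
  by rewrite sin0.
have [c _ ->] := sin_mean_value x0.
by rewrite normrM ler_piMl ?normr_ge0// cos_max.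
Qed.

(** By two applications of the mean value theorem, sin x = x cos c with
0 < c < x, and cos c = 1 - c sin e with 0 < e < c, which is at least 1 - x. *)
Lemma sin_ge (x : R) : 0 < x -> x * (1 - x) <= sin x.
Proof.
move=> x0; have [c /andP[c0 cx] ->] := sin_mean_value x0.
rewrite mulrC ler_wpM2r ?(ltW x0)//.
have [] := @MVT R cos (fun t : R => - sin t) 0 c c0.
- by apply: continuous_subspaceT; exact: continuous_cos.
move=> e /[!in_itv]/= /andP[e0 ec]; rewrite cos0 subr0 => /eqP.
rewrite subr_eq => /eqP ->.
have : sin e * c <= x.
  by rewrite (le_trans (ler_wpM2r (ltW c0) (sin_le1 e)))// mul1r ltW.
by lra.
Qed.

(** A chord is at most the difference of the angles, which bounds all inscribed
lengths. The regular inscribed polygon with m vertices has length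
2 m sin (pi / m), at least 2 pi - 2 pi ^ 2 / m. *)
Lemma arc_length_unit_circle : arc_length unit_circle = (2 * pi)%:E.
Proof.
have uE t : unit_circle t = (cos (2 * pi * t), sin (2 * pi * t)).
  by rewrite /unit_circle /circle_path/= !add0r !mul1r.
have pi0 := pi_gt0 R.
apply/eqP; rewrite eq_le; apply/andP; split.
  have -> : 2 * pi = 2 * pi * 1 - 2 * pi * 0 :> R by ring.
  apply: (@arc_length_le _ unit_circle (fun t => 2 * pi * t)) => s t s0 st t1.
  rewrite !uE chord.
  have E : 2 * pi * t - 2 * pi * s = 2 * `|(2 * pi * t - 2 * pi * s) / 2|.
    rewrite ger0_norm; first by field.
    by rewrite -mulrBr divr_ge0// mulr_ge0 ?mulr_ge0 ?subr_ge0// ltW.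
  by rewrite [leRHS]E ler_wpM2l// sin_le.
apply/lee_addgt0Pr => e e0.
(* With this number of vertices the defect 2 pi ^ 2 / m is at most e. *)
pose m := (Num.truncn (2 * pi ^+ 2 / e)).+1.
have m0 : 0 < m%:R :> R by rewrite ltr0n.
have me : 2 * pi * (pi / m%:R) <= e.
  have -> : 2 * pi * (pi / m%:R) = 2 * pi ^+ 2 / m%:R :> R by rewrite expr2 !mulrA.
  rewrite ler_pdivrMr// [leRHS]mulrC -ler_pdivrMr//.
  exact: ltW (truncnS_gt _).
apply: le_trans (leeD2r e%:E (@arc_length_uniform _ unit_circle m isT)).
rewrite -EFinD lee_fin -lerBlDr.
rewrite (eq_bigr (fun=> 2 * sin (pi / m%:R))); last first.
  move=> k _; rewrite !uE chord.
  have -> : (2 * pi * (k.+1%:R / m%:R) - 2 * pi * (k%:R / m%:R)) / 2 =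
            pi / m%:R :> R.
    by rewrite -natr1; field; rewrite gt_eqF.
  rewrite ger0_norm// sin_ge0_pi// (divr_ge0 (ltW pi0) (ltW m0))/=.
  by rewrite ler_pdivrMr// ler_peMr ?(ltW pi0)// ler1n.
rewrite sumr_const_nat subn0 -[_ *+ m]mulr_natr.
have h := sin_ge (divr_gt0 pi0 m0).
apply: (@le_trans _ _ (2 * (pi / m%:R * (1 - pi / m%:R)) * m%:R)).
  have -> : 2 * (pi / m%:R * (1 - pi / m%:R)) * m%:R =
            2 * pi - 2 * pi * (pi / m%:R) :> R.
    by field; rewrite gt_eqF.
  by rewrite lerD2l lerN2.
by rewrite ler_wpM2r ?(ltW m0)// ler_wpM2l.
Qed.

(** The angle of (x, y) is acos x on the upper half and 2 pi - acos x on the lower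
one. *)
Lemma unit_circle_image :
  curve_image unit_circle = [set p | p.1 ^+ 2 + p.2 ^+ 2 = 1].
Proof.
have pi0 := pi_gt0 R.
apply/seteqP; split => [_ [t _ <-]|[x y] /= xy1].
  by rewrite /unit_circle /circle_path/= !add0r !mul1r cos2Dsin2.
have p2 : 0 < 2 * pi :> R by rewrite mulr_gt0.
have p2' := ltW p2.
have x1 : -1 <= x <= 1 by have := sqr_ge0 y => ?; apply/andP; split; nra.
have ac0 := acos_ge0 x1; have acpi := acos_lepi x1.
have sE : sin (acos x) = `|y|.
  by rewrite sin_acos// -[RHS]sqrtr_sqr; congr Num.sqrt; lra.
have [y0|y0] := leP 0 y.
  exists (acos x / (2 * pi)).
    by rewrite /= in_itv/= divr_ge0//= ler_pdivrMr//; lra.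
  rewrite /unit_circle /circle_path/= !add0r !mul1r mulrC divfK ?mulf_neq0 ?gt_eqF//.
  by rewrite acosK ?in_itv// sE ger0_norm.
exists (1 - acos x / (2 * pi)).
  by rewrite /= in_itv/= subr_ge0 ler_pdivrMr// gerBl divr_ge0// andbT; lra.
rewrite /unit_circle /circle_path/= !add0r !mul1r.
have -> : 2 * pi * (1 - acos x / (2 * pi)) = - acos x + pi *+ 2.
  by rewrite mulrBr mulr1 mulrCA divff ?gt_eqF// mulr1 mulr2n; ring.
by rewrite cosD2pi sinD2pi cosN sinN acosK ?in_itv// sE ltr0_norm// opprK.
Qed.

Lemma seg_convex_unit_disc : seg_convex (@unit_disc R).
Proof.
move=> [a b] [c d] s s01; rewrite /unit_disc/segment_point/= => h1 h2.
have {s01}[s0 s1] : 0 <= s /\ 0 <= 1 - s by case/andP: s01 => ? ?; split; lra.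
apply: (@le_lt_trans _ _ ((1 - s) * (a ^+ 2 + b ^+ 2) + s * (c ^+ 2 + d ^+ 2))).
  have := mulr_ge0 (mulr_ge0 s0 s1) (addr_ge0 (sqr_ge0 (a - c)) (sqr_ge0 (b - d))).
  by nra.
have [->|sn0] := eqVneq s 0; first by lra.
have sp : 0 < s by rewrite lt_neqAle eq_sym sn0.
by have : s * (c ^+ 2 + d ^+ 2) < s * 1; [rewrite ltr_pM2l|nra].
Qed.

Lemma continuous_sqnorm : continuous (fun p : R * R => p.1 ^+ 2 + p.2 ^+ 2).
Proof.
move=> p; apply: cvgD.
  apply: (@continuous_comp _ _ _ fst (fun t : R => t ^+ 2)); first exact: cvg_fst.
  exact: exprn_continuous.
apply: (@continuous_comp _ _ _ snd (fun t : R => t ^+ 2)); first exact: cvg_snd.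
exact: exprn_continuous.
Qed.

Lemma open_unit_disc : open (@unit_disc R : set (R * R)).
Proof.
rewrite (_ : unit_disc = (fun p : R * R => p.1 ^+ 2 + p.2 ^+ 2) @^-1` [set t | t < 1])//.
apply: open_comp; last exact: open_lt.
by move=> p _; exact: continuous_sqnorm.
Qed.

Lemma is_bounded_region_unit_disc : is_bounded_region unit_circle unit_disc.
Proof.
split.
- exact: open_unit_disc.
- exact/seg_convex_connected/seg_convex_unit_disc.
- apply/bounded_abs; exists 1 => -[x y]; rewrite /unit_disc/= => h.
  have := sqr_ge0 x; have := sqr_ge0 y; rewrite !ler_norml => *.
  by split; apply/andP; split; nra.
rewrite unit_circle_image; apply/seteqP; split => p.
  move=> /(open_boundary _ open_unit_disc)[cp /negP np].
  apply/eqP; rewrite eq_le; apply/andP; split; last by rewrite leNgt.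
  have clo : closed ((fun p : R * R => p.1 ^+ 2 + p.2 ^+ 2) @^-1` [set t | t <= 1]).
    apply: closed_comp; last exact: closed_le.
    by move=> ? _; exact: continuous_sqnorm.
  have : closure unit_disc `<=`
      ((fun p : R * R => p.1 ^+ 2 + p.2 ^+ 2) @^-1` [set t | t <= 1]).
    rewrite ((closure_id _).1 clo); apply: closure_subset => q; exact: ltW.
  by move=> /(_ _ cp).
move=> /= p1; apply/(open_boundary _ open_unit_disc); split; last first.
  by rewrite /unit_disc/= p1 ltxx.
apply/closure_close => e e0.
(* A factor in [0, 1[ so close to 1 that the point s p is within e of p. *)
pose s := Num.max (1 - e / 2) 0.
have s0 : 0 <= s by rewrite le_max lexx orbT.
have s1 : s < 1 by rewrite gt_max ltr01 andbT; lra.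
have se : 1 - s < e.
  have : 1 - e / 2 <= s by rewrite le_max lexx.
  by lra.
exists (s * p.1, s * p.2).
  rewrite /unit_disc/= !exprMn -mulrDr p1 mulr1; nra.
have aux (a : R) : a ^+ 2 <= 1 -> `|a - s * a| < e.
  move=> a1; rewrite -{1}[a]mul1r -mulrBl normrM gtr0_norm ?subr_gt0//.
  have : `|a| <= 1 by rewrite ler_norml; apply/andP; split; nra.
  by have := normr_ge0 a; nra.
by split; apply: aux; rewrite -p1 ?lerDl ?lerDr sqr_ge0.
Qed.

Lemma measurable_unit_disc :
  measurable (@unit_disc R : set (mplane R)).
Proof.
rewrite (_ : unit_disc = setT `&`
    (fun p : mplane R => p.1 ^+ 2 + p.2 ^+ 2) @^-1` `]-oo, 1[%classic); last first.
  by rewrite setTI; apply/seteqP; split => p; rewrite /= in_itv.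
have mf : measurable_fun setT
    (fun p : mplane R => p.1 ^+ 2 + p.2 ^+ 2 : measurableTypeR R).
  apply: measurable_funD; apply: measurable_funX.
  - exact: measurable_fst.
  - exact: measurable_snd.
by apply: mf => //; exact: measurable_itv.
Qed.

End circles.

(** What the extremal argument has to know about a circle or a tangential polygon
of radius r and length l. The equation for the area is the common feature of the
two kinds of curves; the other fields serve to rescale the region and to add up
areas. *)
Record tangential_region {R : realType} (C : R -> R * R) (r l : R) : Prop :=
  TangentialRegion {
    tr_radius_gt0 : 0 < r;
    tr_length_gt0 : 0 < l;
    tr_length : arc_length C = l%:E;
    tr_region : is_bounded_region C (region C);
    tr_convex : seg_convex (region C);
    tr_measurable : measurable (region C : set (mplane R));
    tr_area : area (region C) = (r * l / 2)%:E }.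

Lemma circle_tangential_region {R : realType} (C : R -> R * R) r :
  is_circle r C -> tangential_region C r (r * (2 * pi)).
Proof.
case=> r_gt0 [cen Co]; have rn0 : r != 0 by rewrite gt_eqF.
have bC : is_bounded_region (circle_path cen r) (sim r cen @` unit_disc).
  rewrite circle_pathE; apply: is_bounded_region_sim => //.
  exact: is_bounded_region_unit_disc.
have cC : seg_convex (sim r cen @` unit_disc).
  by apply: seg_convex_sim; exact: seg_convex_unit_disc.
have RC : region C = sim r cen @` unit_disc.
  by rewrite (eq_region Co); exact: region_eq.
split => //.
- by rewrite mulr_gt0// mulr_gt0// pi_gt0.
- rewrite (eq_arc_length Co) circle_pathE; apply: arc_length_sim; first exact: ltW.
  exact: arc_length_unit_circle.
- by rewrite RC; case: bC => *; split => //; rewrite (eq_curve_image Co).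
- by rewrite RC.
- by rewrite RC; apply: measurable_sim => //; exact: measurable_unit_disc.
- rewrite RC area_sim//; last exact: measurable_unit_disc.
  by rewrite area_unit_disc -EFinM; congr EFin; field.
Qed.

(** * Length of a closed polygonal line *)

Section polygon_length.
Context {R : realType}.
Variable vs : seq (R * R).
Hypothesis vs_gt0 : (0 < size vs)%N.
Local Notation m := (size vs).
Local Notation v := (vertex vs).

Definition side_length (k : nat) : R := edist (v k) (v k.+1).

Definition perimeter : R := \sum_(0 <= k < m) side_length k.

(** The path of the polygon in the parameter u = t * size vs, for which the side k
occupies the interval [k, k + 1]. *)
Definition broken_line (u : R) : R * R :=
  let k := Num.truncn u in segment_point (v k) (v k.+1) (u - k%:R).

Definition cumulative_length (u : R) : R :=
  let k := Num.truncn u in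
  \sum_(0 <= i < k) side_length i + (u - k%:R) * side_length k.

Lemma vertex_size : v m = v 0%N.
Proof. by rewrite /vertex modnn mod0n. Qed.

Lemma segment_point0 (p q : R * R) : segment_point p q 0 = p.
Proof. by rewrite segment_pointE !mul0r !addr0 -surjective_pairing. Qed.

Lemma segment_point1 (p q : R * R) : segment_point p q 1 = q.
Proof.
by rewrite segment_pointE !mul1r !(addrC p.1, addrC p.2) !subrK -surjective_pairing.
Qed.

(** The right end u = k + 1, which the truncation assigns to the next side, is the
common vertex of the two sides. *)
Lemma on_side k (u : R) : k%:R <= u <= k.+1%:R ->
  broken_line u = segment_point (v k) (v k.+1) (u - k%:R) /\
  cumulative_length u = \sum_(0 <= i < k) side_length i + (u - k%:R) * side_length k.
Proof.
move=> /andP[ku]; rewrite le_eqVlt => /predU1P[->|uk]; last first.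
  by rewrite /broken_line /cumulative_length (@truncn_def _ u k)// ku uk.
have kk : k.+1%:R - k%:R = 1 :> R by rewrite -natr1 addrC addKr.
rewrite /broken_line /cumulative_length natrK subrr kk mul0r mul1r addr0.
by rewrite segment_point0 segment_point1 big_nat_recr.
Qed.

Lemma broken_line_nat k : broken_line k%:R = v k.
Proof. by rewrite /broken_line natrK subrr segment_point0. Qed.

Lemma cumulative_length_nat k :
  cumulative_length k%:R = \sum_(0 <= i < k) side_length i.
Proof. by rewrite /cumulative_length natrK subrr mul0r addr0. Qed.

(** On one side this is an equality. In general cut at the last integer before w
and apply the triangle inequality. *)
Lemma cumulative_length_lipschitz (u w : R) : 0 <= u -> u <= w ->
  edist (broken_line w) (broken_line u) <= cumulative_length w - cumulative_length u.
Proof.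
move=> u0 uw.
have same_side k (a b : R) : k%:R <= a -> a <= b -> b <= k.+1%:R ->
    edist (broken_line b) (broken_line a) <= cumulative_length b - cumulative_length a.
  move=> ka ab bk.
  have [|-> ->] := @on_side k a; first by rewrite ka (le_trans ab).
  have [|-> ->] := @on_side k b; first by rewrite bk (le_trans ka).
  have ab0 : 0 <= b - k%:R - (a - k%:R) by lra.
  rewrite eucl_dist_segment ger0_norm// -/(side_length k).
  by rewrite le_eqVlt; apply/orP; left; apply/eqP; ring.
have wn : w <= (Num.truncn w).+1%:R by exact: ltW (truncnS_gt w).
move: (Num.truncn w).+1 wn => n; elim: n => [|n IH] in w uw *.
  by move=> w0; apply: (same_side 0%N) => //; apply: le_trans w0 _.
move=> wn; have [wn'|nw] := leP w n%:R; first exact: IH.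
have [nu|un] := leP n%:R u; first exact: (same_side n).
apply: le_trans (eucl_dist_triangle _ (broken_line n%:R) _) _.
rewrite -[leRHS](subrKA (cumulative_length n%:R)).
apply: lerD; first by apply: (same_side n) => //; exact: ltW.
by apply: IH => //; exact: ltW.
Qed.

(** The cumulative length bounds all inscribed lengths, and the line inscribed at
the vertices attains it. *)
Lemma arc_length_polygon_path : arc_length (polygon_path vs) = perimeter%:E.
Proof.
have m0 : 0 < m%:R :> R by rewrite ltr0n.
apply/eqP; rewrite eq_le; apply/andP; split.
  have -> : perimeter = cumulative_length (1 * m%:R) - cumulative_length (0 * m%:R).
    rewrite mul1r mul0r (cumulative_length_nat 0) cumulative_length_nat.
    by rewrite (@big_geq _ _ _ 0 0)// subr0.
  apply: (@arc_length_le _ _ (fun t => cumulative_length (t * m%:R))) => s t s0 st t1.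
  by apply: cumulative_length_lipschitz; rewrite ?mulr_ge0 ?(ltW m0)// ler_pM2r.
apply: le_trans (@arc_length_uniform _ (polygon_path vs) m vs_gt0).
rewrite lee_fin /perimeter; apply: ler_sum => k _.
have pathE (j : nat) : polygon_path vs (j%:R / m%:R) = v j.
  by rewrite -broken_line_nat -[in RHS](@divfK _ m%:R _ j%:R) ?gt_eqF.
by rewrite !pathE eucl_distC.
Qed.

Lemma polygon_path_side (t : R) : 0 <= t < 1 ->
  exists k s, [/\ (k < m)%N, 0 <= s < 1 &
                  polygon_path vs t = segment_point (v k) (v k.+1) s].
Proof.
move=> /andP[t0 t1]; have m0 : 0 < m%:R :> R by rewrite ltr0n.
have tm : 0 <= t * m%:R by rewrite mulr_ge0// ltW.
have /andP[kt tk] := truncn_itv tm.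
exists (Num.truncn (t * m%:R)), (t * m%:R - (Num.truncn (t * m%:R))%:R); split => //.
- by rewrite truncn_lt_nat// -[ltRHS]mul1r ltr_pM2r.
- by rewrite subr_ge0 kt ltrBlDl -[_ + 1](natrD _ _ 1) addn1.
Qed.

Lemma side_polygon_path k (s : R) : (k < m)%N -> 0 <= s < 1 ->
  let t := (k%:R + s) / m%:R in
  0 <= t < 1 /\ polygon_path vs t = segment_point (v k) (v k.+1) s.
Proof.
move=> km /andP[s0 s1] t; have m0 : 0 < m%:R :> R by rewrite ltr0n.
have k1m : k.+1%:R <= m%:R :> R by rewrite ler_nat.
have ks : k%:R + s < k.+1%:R by rewrite -natr1 ltrD2l.
split.
  rewrite /t divr_ge0 ?addr_ge0 ?ler0n ?(ltW m0)//=.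
  by rewrite ltr_pdivrMr// mul1r (lt_le_trans ks).
rewrite -[LHS]/(broken_line (t * m%:R)) divfK ?gt_eqF//.
by have [|-> _] := @on_side k (k%:R + s); rewrite ?lerDl ?s0 ?ltW// addrAC subrr add0r.
Qed.

Lemma polygon_path1 : polygon_path vs 1 = polygon_path vs 0.
Proof.
rewrite -[LHS]/(broken_line (1 * m%:R)) -[RHS]/(broken_line (0 * m%:R)).
by rewrite mul1r mul0r broken_line_nat vertex_size -broken_line_nat.
Qed.

Lemma polygon_image_side x : curve_image (polygon_path vs) x <->
  exists k s, [/\ (k < m)%N, 0 <= s < 1 & x = segment_point (v k) (v k.+1) s].
Proof.
split=> [[t]|[k [s [km s01 ->]]]]; last first.
  have [/andP[t0 t1] <-] := side_polygon_path km s01.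
  by exists ((k%:R + s) / m%:R) => //=; rewrite in_itv/= t0 ltW.
rewrite /= in_itv/= => /andP[t0]; rewrite le_eqVlt => /predU1P[->|t1] <-.
  rewrite polygon_path1; have [|k [s [km s01 ->]]] := @polygon_path_side 0.
    by rewrite lexx ltr01.
  by exists k, s.
by have [|k [s [km s01 ->]]] := @polygon_path_side t; [rewrite t0|exists k, s].
Qed.

End polygon_length.

(** * Finite unions and cones *)

Section finite_union.
Context {R : realType}.

Lemma area_bigcup_ord n (F : 'I_n -> set (R * R)) :
  (forall i, measurable (F i : set (mplane R))) ->
  trivIset setT F ->
  area (\bigcup_(i in [set: 'I_n]) F i) = (\sum_(i < n) area (F i))%E.
Proof.
move=> mF tF.
have -> : \bigcup_(i in [set: 'I_n]) F i = \big[setU/set0]_(i < n) F i.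
  have -> : [set: 'I_n] = [set` index_enum (Finite.clone _ 'I_n)].
    by apply/seteqP; split => i //= _; exact: mem_index_enum.
  exact: bigcup_seq.
exact: measure_bigsetU_ord.
Qed.

Lemma measurable_bigcup_ord n (F : 'I_n -> set (R * R)) :
  (forall i, measurable (F i : set (mplane R))) ->
  measurable (\bigcup_(i in [set: 'I_n]) F i : set (mplane R)).
Proof. by move=> mF; apply: fin_bigcup_measurable. Qed.

Lemma point_setX (p : R * R) :
  [set p] = ([set p.1] `*` [set p.2] : set (mplane R)).
Proof.
by case: p => a b; apply/seteqP; split => [_ -> //|[x y] /= [-> ->]].
Qed.

Lemma measurable_point (p : R * R) :
  measurable ([set p] : set (mplane R)).
Proof. by rewrite point_setX; apply: measurableX; exact: measurable_set1. Qed.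

Lemma area_point (p : R * R) : area [set p] = 0%E.
Proof.
rewrite point_setX [LHS]product_measure1E; [|exact: measurable_set1..].
by rewrite /= !lebesgue_measure_set1 mule0.
Qed.

End finite_union.

Section cones.
Context {R : realType}.
Implicit Types (o p q x y : R * R).

Definition det2 x y : R := x.1 * y.2 - x.2 * y.1.

(** The open segments from o to the points of the half-open segment [p, q[. The
apex is left out, being common to all cones with that apex. *)
Definition cone o p q : set (R * R) :=
  [set y | exists s t, [/\ 0 <= s < 1, 0 < t < 1 &
                           y = segment_point o (segment_point p q s) t]].

(** The two components are the coordinates of y - o in the basis (p - o, q - o),
obtained by Cramer's rule. The point at parameters s and t has coordinates
t (1 - s) and t s. *)
Lemma cone_affine o p q : let D := det2 (p - o) (q - o) in D != 0 ->
  cone o p q = (fun y : R * R =>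
     ((q - o).2 / D * y.1 + - (q - o).1 / D * y.2
        + (o.2 * (q - o).1 - o.1 * (q - o).2) / D,
      - (p - o).2 / D * y.1 + (p - o).1 / D * y.2
        + (o.1 * (p - o).2 - o.2 * (p - o).1) / D))
   @^-1` unit_triangle.
Proof.
move=> D; case: o p q @D => [z1 z2] [p1 p2] [q1 q2]; rewrite /det2/= => D0.
set D := (X in X != 0) in D0 *.
apply/seteqP; split.
  move=> _ [s [t [/andP[s0 s1] /andP[t0 t1] ->]]].
  rewrite /unit_triangle/segment_point/=.
  set a := (X in 0 < X); set b := (X in 0 <= X).
  have -> : a = t * (1 - s) by rewrite /a /D; field.
  have -> : b = t * s by rewrite /b /D; field.
  split; [by rewrite mulr_gt0// subr_gt0|by rewrite mulr_ge0// ltW|].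
  by rewrite [ltLHS](_ : _ = t)//; rewrite /D; field.
move=> [y1 y2]; rewrite /unit_triangle/=.
set a := (X in 0 < X); set b := (X in 0 <= X) => -[a0 b0 ab1].
have ab0 : 0 < a + b by rewrite ltr_pwDl.
exists (b / (a + b)), (a + b); split.
- by rewrite divr_ge0 ?(ltW ab0)//= ltr_pdivrMr// mul1r ltrDr.
- by rewrite ab0.
rewrite /segment_point/=.
have -> : (1 - b / (a + b)) = a / (a + b) by field; rewrite gt_eqF.
congr pair.
  have -> : (1 - (a + b)) * z1 + (a + b) * (a / (a + b) * p1 + b / (a + b) * q1) =
            z1 + a * (p1 - z1) + b * (q1 - z1) by field; rewrite gt_eqF.
  by rewrite /a /b /D; field.
have -> : (1 - (a + b)) * z2 + (a + b) * (a / (a + b) * p2 + b / (a + b) * q2) =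
          z2 + a * (p2 - z2) + b * (q2 - z2) by field; rewrite gt_eqF.
by rewrite /a /b /D; field.
Qed.

Lemma measurable_unit_triangle : measurable (@unit_triangle R).
Proof.
have mf1 := @measurable_affine2 R 1 0 0; have mf2 := @measurable_affine2 R 0 1 0.
have mf3 := @measurable_affine2 R 1 1 0.
rewrite (_ : unit_triangle =
  [set: _] `&` (fun p => 1 * p.1 + 0 * p.2 + 0) @^-1` `]0, +oo[%classic `&`
  ([set: _] `&` (fun p => 0 * p.1 + 1 * p.2 + 0) @^-1` `[0, +oo[%classic) `&`
  ([set: _] `&` (fun p => 1 * p.1 + 1 * p.2 + 0) @^-1` `]-oo, 1[%classic)); last first.
  rewrite !setTI; apply/seteqP; split => p;
    rewrite /unit_triangle/= !in_itv/= !andbT !mul1r !mul0r !addr0 add0r.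
    by case=> -> -> ->.
  by case=> -[-> ->] ->.
apply: measurableI; first apply: measurableI.
- by apply: mf1 => //; exact: measurable_itv.
- by apply: mf2 => //; exact: measurable_itv.
- by apply: mf3 => //; exact: measurable_itv.
Qed.

Lemma area_cone o p q : det2 (p - o) (q - o) != 0 ->
  measurable (cone o p q : set (mplane R)) /\
  area (cone o p q) = (`|det2 (p - o) (q - o)| / 2)%:E.
Proof.
move=> D0; rewrite cone_affine//; set D := det2 _ _ in D0 *.
split; first by apply: measurable_preimage_affine; exact: measurable_unit_triangle.
set a := (q - o).2 / D; set b := - (q - o).1 / D.
set c := - (p - o).2 / D; set d := (p - o).1 / D.
set e := (o.2 * (q - o).1 - o.1 * (q - o).2) / D.
set f := (o.1 * (p - o).2 - o.2 * (p - o).1) / D.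
have E : a * d - b * c = D^-1.
  rewrite /a /b /c /d.
  have -> : (q - o).2 / D * ((p - o).1 / D) - - (q - o).1 / D * (- (p - o).2 / D)
     = det2 (p - o) (q - o) / D / D by rewrite /det2; field.
  by rewrite -/D divff// mul1r.
have ne0 : a * d - b * c != 0 by rewrite E invr_eq0.
have := area_affine e f ne0 measurable_unit_triangle.
rewrite area_unit_triangle E => h.
have -> : (`|D| / 2)%:E = (`|D|%:E * (2^-1)%:E)%E :> \bar R by rewrite EFinM.
rewrite -h muleA -EFinM -normrM divff// normr1 mul1e//.
Qed.

(** The determinant equals det (n, e), where n leads from o to the point of contact
and e = q - p. As n is orthogonal to e, the identity
det (n, e) ^ 2 + (n . e) ^ 2 = |n| ^ 2 |e| ^ 2 gives the result. *)
Lemma det2_tangent o r p q : 0 <= r -> tangent_to_segment o r p q ->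
  `|det2 (p - o) (q - o)| = r * edist p q.
Proof.
move=> r0 [s s01 [xr xn]].
have xr2 : r ^+ 2 = ((segment_point p q s).1 - o.1) ^+ 2 +
                    ((segment_point p q s).2 - o.2) ^+ 2.
  rewrite -xr /edist sqr_sqrtr ?addr_ge0 ?sqr_ge0//.
  by rewrite -(sqrrN (o.1 - _)) -(sqrrN (o.2 - _)) !opprB.
apply/eqP; rewrite -(@eqrXn2 _ 2)// ?mulr_ge0 ?eucl_dist_ge0// real_normK ?num_real//.
rewrite exprMn xr2 /edist sqr_sqrtr ?addr_ge0 ?sqr_ge0//.
move: xn; case: o p q {xr xr2} => [z1 z2] [p1 p2] [q1 q2].
rewrite /segment_point /det2/= => xn.
set n1 := (1 - s) * p1 + s * q1 - z1 in xn *.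
set n2 := (1 - s) * p2 + s * q2 - z2 in xn *.
apply/eqP.
have -> : (p1 - z1) * (q2 - z2) - (p2 - z2) * (q1 - z1) =
          n1 * (q2 - p2) - n2 * (q1 - p1).
  by rewrite /n1 /n2; ring.
transitivity ((n1 * (q2 - p2) - n2 * (q1 - p1)) ^+ 2 +
              (n1 * (q1 - p1) + n2 * (q2 - p2)) ^+ 2).
  by rewrite xn expr0n addr0.
ring.
Qed.

End cones.

(** * Area of a convex tangential polygon *)

Section convex_cones.
Context {R : realType}.
Implicit Types (o p q x y : R * R) (D : set (R * R)).

Lemma segment_point_cross (z x x' : R * R) (t t' : R) : t' != 0 ->
  segment_point z x t = segment_point z x' t' -> segment_point z x (t / t') = x'.
Proof.
case: z x x' => [z1 z2] [x1 x2] [y1 y2] t0; rewrite /segment_point/= => -[e1 e2].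
congr pair.
  have -> : y1 = ((1 - t') * z1 + t' * y1 - (1 - t') * z1) / t' by field.
  by rewrite -e1; field.
have -> : y2 = ((1 - t') * z2 + t' * y2 - (1 - t') * z2) / t' by field.
by rewrite -e2; field.
Qed.

(** Of two distinct boundary points on the same ray from z, the nearer would be
strictly between z and the farther one, hence in D. *)
Lemma boundary_ray_inj D z x x' (t t' : R) : open D -> seg_convex D -> D z ->
  boundary D x -> boundary D x' -> 0 < t -> 0 < t' ->
  segment_point z x t = segment_point z x' t' -> x = x'.
Proof.
move=> oD cD Dz; wlog tt' : x x' t t' / t <= t'.
  move=> h bx bx' t0 t'0 e; have [tt'|/ltW t't] := leP t t'; first exact: (h x x' t t').
  by apply/esym/(h x' x t' t).
move=> /(open_boundary _ oD)[cx _] /(open_boundary _ oD)[_ nx'] t0 t'0.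
move=> /(segment_point_cross (lt0r_neq0 t'0)) e.
move: tt'; rewrite le_eqVlt => /predU1P[tE|tlt].
  by rewrite -e tE divff ?gt_eqF// segment_point1.
case: nx'; rewrite -e; apply: open_segment_closure => //.
by rewrite divr_ge0 ?ltW//= ltr_pdivrMr// mul1r.
Qed.

(** If p is any point of D other than z, the point of the circle opposite to p is in
the closure of D, and z is strictly between the two. *)
Lemma incenter_in D z (r : R) : open D -> seg_convex D -> D !=set0 -> 0 < r ->
  curve_image (circle_path z r) `<=` closure D -> D z.
Proof.
move=> oD cD [p Dp] r0 circD.
have [->//|pz] := eqVneq z p.
pose l := edist p z.
have l0 : 0 < l.
  rewrite lt_neqAle eucl_dist_ge0 andbT eq_sym.
  by apply: contra_neq pz => /eucl_dist_eq0.
have l2 : l ^+ 2 = (p.1 - z.1) ^+ 2 + (p.2 - z.2) ^+ 2.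
  by rewrite sqr_sqrtr// addr_ge0 ?sqr_ge0.
(* The unit vector from p towards z. *)
pose w : R * R := (- (p.1 - z.1) / l, - (p.2 - z.2) / l).
have cy : closure D (sim r z w).
  apply: circD; rewrite circle_pathE curve_image_sim unit_circle_image; exists w => //=.
  by rewrite !expr_div_n !sqrrN -mulrDl -l2 divff// expf_neq0// gt_eqF.
have lr : 0 < l + r by rewrite addr_gt0.
have := open_segment_closure oD cD Dp cy (t := l / (l + r)).
rewrite divr_ge0 ?ltW//= ltr_pdivrMr// mul1r ltrDl r0 => /(_ isT).
congr D; rewrite /segment_point /sim/= [RHS]surjective_pairing.
by congr pair; field; rewrite !gt_eqF.
Qed.

(** A point of D other than z lies on a segment from z to the boundary by
[ray_exit], which gives the covering. Disjointness combines the uniqueness of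
that boundary point with the injectivity of the path, each boundary point being
on exactly one half-open side. *)
Lemma cone_decomposition (vs : seq (R * R)) D z :
  (0 < size vs)%N -> simple_closed (polygon_path vs) ->
  is_bounded_region (polygon_path vs) D -> seg_convex D -> D z ->
  let K (k : 'I_(size vs)) := cone z (vertex vs k) (vertex vs k.+1) in
  [/\ D = [set z] `|` \bigcup_(k in [set: 'I_(size vs)]) K k,
      [set z] `&` \bigcup_(k in [set: 'I_(size vs)]) K k = set0 & trivIset setT K].
Proof.
move=> vs0 [_ _ injC] [oD _ bD bE] cD Dz K.
have side_boundary (k : 'I_(size vs)) (s : R) : 0 <= s < 1 ->
    boundary D (segment_point (vertex vs k) (vertex vs k.+1) s).
  move=> s01; rewrite bE; apply/polygon_image_side => //.
  by exists (val k), s; split => //; exact: ltn_ord.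
split.
- apply/seteqP; split => [y Dy|y [->//|[k _ [s [t [s01 t01 ->]]]]]]; last first.
    have /(open_boundary _ oD)[cx _] := side_boundary k s s01.
    apply: open_segment_closure => //.
    by case/andP: t01 => /ltW -> ->.
  have [->|yz] := eqVneq y z; first by left.
  right; have yz0 : y - z != 0 by rewrite subr_eq0.
  have [tau tau0] := ray_exit oD bD Dy yz0.
  rewrite bE => /polygon_image_side-/(_ vs0)[k [s [km s01 xE]]].
  exists (Ordinal km) => //; exists s, (1 + tau)^-1; split => //.
    by rewrite invr_gt0 addr_gt0//= invf_lt1 ?addr_gt0// ltrDl.
  rewrite -xE segment_pointE/= [LHS]surjective_pairing.
  by congr pair; rewrite /GRing.scale/=; field; rewrite gt_eqF// addr_gt0.
- apply/seteqP; split => // _ [-> [k _ [s [t [s01 /andP[t0 t1] e]]]]].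
  have /(open_boundary _ oD)[_] := side_boundary k s s01; apply.
  have zz : segment_point z z 1 = z.
    by rewrite segment_pointE !subrr !mulr0 !addr0 -surjective_pairing.
  have e' : segment_point z z t =
            segment_point z (segment_point (vertex vs k) (vertex vs k.+1) s) t.
    by rewrite -e segment_pointE !subrr !mulr0 !addr0 -surjective_pairing.
  by have := segment_point_cross (lt0r_neq0 t0) e'; rewrite divff ?gt_eqF// zz => <-.
- apply/trivIsetP => j k _ _ jk; apply/seteqP; split => // y [].
  move=> [s [t [s01 /andP[t0 _] ->]]] [s' [t' [s'01 /andP[t'0 _] e]]].
  have := boundary_ray_inj oD cD Dz (side_boundary j s s01)
    (side_boundary k s' s'01) t0 t'0 e.
  have [h1 <-] := side_polygon_path vs0 (ltn_ord j) s01.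
  have [h2 <-] := side_polygon_path vs0 (ltn_ord k) s'01.
  move=> /injC; rewrite !inE/= !in_itv/= => /(_ h1 h2).
  move/(congr1 ( *%R^~ (size vs)%:R)); rewrite !divfK ?pnatr_eq0 -?lt0n// => ks.
  have trunc_side (i : nat) (a : R) : 0 <= a < 1 -> Num.truncn (i%:R + a) = i.
    by move=> /andP[a0 a1]; apply: truncn_def; rewrite lerDl a0 -natr1 ltrD2l.
  by case/eqP: jk; apply/val_inj; rewrite /= -(trunc_side j s s01) ks trunc_side.
Qed.

(** Vertices with different indices below size vs are different values of the path
on [0, 1[. The successor of the last vertex is vertex 0, which is another vertex
because there are at least two. *)
Lemma side_neq (vs : seq (R * R)) k :
  (1 < size vs)%N -> simple_closed (polygon_path vs) -> (k < size vs)%N ->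
  vertex vs k != vertex vs k.+1.
Proof.
move=> vs1 [_ _ injC] km; have vs0 : (0 < size vs)%N by exact: ltnW.
have h01 : 0 <= (0 : R) < 1 by rewrite lexx ltr01.
have m0 : (size vs)%:R != 0 :> R by rewrite pnatr_eq0 -lt0n.
have vertexE j : (j < size vs)%N -> 0 <= (j%:R / (size vs)%:R : R) < 1 /\
    polygon_path vs (j%:R / (size vs)%:R) = vertex vs j.
  by move=> jm; have := side_polygon_path vs0 jm h01; rewrite addr0 segment_point0.
have injv i j : (i < size vs)%N -> (j < size vs)%N ->
    vertex vs i = vertex vs j -> i = j.
  move=> /vertexE[i01 <-] /vertexE[j01 <-] /injC.
  rewrite !inE/= !in_itv/= => /(_ i01 j01).
  by move/(congr1 ( *%R^~ (size vs)%:R)); rewrite !divfK// => /eqP; rewrite eqr_nat => /eqP.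
apply/eqP => vk; move: (km); rewrite leq_eqVlt => /predU1P[kE|k1m].
  have v0E : vertex vs k.+1 = vertex vs 0 by rewrite kE vertex_size.
  have k0 := injv k 0%N km vs0 (etrans vk v0E).
  by move: vs1; rewrite -kE k0.
by have /eqP := injv k k.+1 km k1m vk; rewrite ltn_eqF.
Qed.

(** The class of C enters only through the positivity of the area, which shows that
C bounds a region. *)
Lemma polygon_tangential_region (C : R -> R * R) r (lambda : R) :
  0 < lambda -> in_class lambda C -> is_convex_tangential_polygon r C ->
  exists l, tangential_region C r l.
Proof.
move=> lambda0 [_ _ areaC] [vs [[vs3 sc cv] [z [r0 circD tan]] Cvs]].
have vs0 : (0 < size vs)%N by exact: leq_trans vs3.
have lenC : arc_length C = (perimeter vs)%:E.
  by rewrite (eq_arc_length Cvs) arc_length_polygon_path.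
have side0 k : (k < size vs)%N -> 0 < side_length vs k.
  move=> km; rewrite lt_neqAle eucl_dist_ge0 andbT eq_sym.
  by apply/eqP => /eucl_dist_eq0; apply/eqP/side_neq => //; exact: leq_trans vs3.
have per0 : 0 < perimeter vs.
  rewrite /perimeter big_mkord (bigD1 (Ordinal vs0))//= ltr_pwDl ?side0//.
  by apply: sumr_ge0 => k _; exact: eucl_dist_ge0.
have regC := eq_region Cvs.
have bC : is_bounded_region C (region C).
  apply: region_is_bounded_region; rewrite areaC lenC -!EFinM eqe.
  by rewrite !mulf_neq0// gt_eqF.
have bP : is_bounded_region (polygon_path vs) (region C).
  by case: bC => *; split => //; rewrite -(eq_curve_image Cvs).
have cD : seg_convex (region C) by rewrite regC; apply/convex_setP.
have Dz : region C z.
  case: (bP) => oD _ _ bE.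
  apply: (@incenter_in _ z r) => //; last by rewrite regC.
  have : boundary (region C) (polygon_path vs 0).
    by rewrite bE; exists 0 => //=; rewrite in_itv/= lexx ler01.
  by move=> [/closure_close/(_ _ ltr01)[p Rp _] _]; exists p.
have [DE disj triv] := cone_decomposition vs0 sc bP cD Dz.
have coneE (k : 'I_(size vs)) :
    measurable (cone z (vertex vs k) (vertex vs k.+1) : set (mplane R))
    /\ area (cone z (vertex vs k) (vertex vs k.+1)) = (r * side_length vs k / 2)%:E.
  have detE := det2_tangent (ltW r0) (tan k (ltn_ord k)).
  have [|mK ->] := @area_cone _ z (vertex vs k) (vertex vs k.+1).
    by rewrite -normr_gt0 detE mulr_gt0// side0.
  by split => //; rewrite detE.
have mU := measurable_bigcup_ord (fun k => (coneE k).1).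
exists (perimeter vs); split => //.
- by rewrite DE; apply: measurableU => //; exact: measurable_point.
- rewrite DE; transitivity (area [set z] + area (\bigcup_(k in [set: 'I_(size vs)])
      cone z (vertex vs k) (vertex vs k.+1)))%E.
    by apply: measureU => //; exact: measurable_point.
  rewrite area_point add0e area_bigcup_ord//; last first.
    by move=> k; have [] := coneE k.
  under eq_bigr do rewrite (coneE _).2.
  by rewrite sumEFin /perimeter big_mkord -mulr_suml -mulr_sumr.
Qed.

End convex_cones.

(** * Rescaled tuples and the minimum *)

Section competitors.
Context {R : realType}.
Implicit Types (C : R -> R * R) (r l lambda c : R) (d : R * R).

Definition tangential_curve r C : Prop :=
  is_convex_tangential_polygon r C \/ is_circle r C.

Lemma tangential_curve_region C r lambda : 0 < lambda -> in_class lambda C ->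
  tangential_curve r C -> exists l, tangential_region C r l.
Proof.
move=> lambda0 lC [polC|circC]; first exact: (polygon_tangential_region lambda0 lC).
by eexists; exact: circle_tangential_region circC.
Qed.

(** Compare the two expressions r l / 2 and lambda l ^ 2 of the area. *)
Lemma tangential_radius C r l lambda :
  in_class lambda C -> tangential_region C r l -> r = 2 * lambda * l.
Proof.
move=> [_ _ aC] [_ l0 lE _ _ _]; rewrite aC lE -!EFinM => -[e].
by apply: (mulIf (lt0r_neq0 l0)); move: e; lra.
Qed.

Lemma region_sim C c d : c != 0 -> is_bounded_region C (region C) ->
  seg_convex (region C) -> region (sim c d \o C) = sim c d @` region C.
Proof.
move=> c0 bC cC; apply: region_eq; first exact: is_bounded_region_sim.
exact: seg_convex_sim.
Qed.

Lemma in_class_sim C r l lambda c d : 0 < c -> in_class lambda C ->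
  tangential_region C r l -> in_class lambda (sim c d \o C).
Proof.
move=> c0 [sC _ aC] [_ _ lE bC cC mC _]; have cn0 := lt0r_neq0 c0.
have lsE := @arc_length_sim R c d C l (ltW c0) lE.
split; first exact: simple_closed_sim.
  by rewrite /rectifiable lsE ltry.
rewrite region_sim// area_sim// aC lE lsE -!EFinM; congr EFin; ring.
Qed.

Lemma vertex_sim c d (vs : seq (R * R)) k : (0 < size vs)%N ->
  vertex (map (sim c d) vs) k = sim c d (vertex vs k).
Proof.
move=> vs0; rewrite /vertex size_map (nth_map (0, 0))// ltn_mod//.
Qed.

Lemma polygon_path_sim c d (vs : seq (R * R)) : (0 < size vs)%N ->
  polygon_path (map (sim c d) vs) = sim c d \o polygon_path vs.
Proof.
move=> vs0; apply/funext => t.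
by rewrite /polygon_path /= !vertex_sim// size_map sim_segment.
Qed.

Lemma tangential_curve_sim C r c d : 0 < c ->
  is_bounded_region C (region C) -> seg_convex (region C) ->
  tangential_curve r C -> tangential_curve (c * r) (sim c d \o C).
Proof.
move=> c0 bC cC; have cn0 := lt0r_neq0 c0.
case=> [[vs [[vs3 sc _] [z [r0 circD tan]] Cvs]]|[r0 [z Cz]]]; last first.
  right; split; first exact: mulr_gt0.
  exists (sim c d z) => t t01; rewrite /= Cz// /circle_path /sim /=.
  by congr pair; ring.
left; have vs0 : (0 < size vs)%N by exact: leq_trans vs3.
have RE : region (polygon_path (map (sim c d) vs)) = sim c d @` region C.
  rewrite polygon_path_sim// -region_sim//; apply: eq_region => t t01.
  by rewrite /= Cvs.
exists (map (sim c d) vs); split.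
- split; first by rewrite size_map.
    by rewrite polygon_path_sim//; exact: simple_closed_sim.
  by rewrite RE; apply/convex_setP; exact: seg_convex_sim.
- exists (sim c d z); split; first exact: mulr_gt0.
    rewrite RE closure_sim// (_ : circle_path _ _ = sim c d \o circle_path z r).
      by rewrite curve_image_sim; apply: image_subset; rewrite (eq_region Cvs).
    by apply/funext => t; rewrite /circle_path /sim/=; congr pair; ring.
  move=> k; rewrite size_map => km; rewrite !vertex_sim//.
  have [s s01 [xr xn]] := tan k km; exists s => //=; rewrite -sim_segment; split.
    by rewrite sim_edist ?xr// ltW.
  rewrite /sim/=; move: xn; move: (vertex vs k) (vertex vs k.+1) => p q xn.
  rewrite [LHS](_ : _ = c ^+ 2 * (((segment_point p q s).1 - z.1) * (q.1 - p.1) +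
    ((segment_point p q s).2 - z.2) * (q.2 - p.2))); last first.
    by rewrite /segment_point/=; ring.
  by rewrite xn mulr0.
- by move=> t t01; rewrite polygon_path_sim//= Cvs.
Qed.

Lemma admissible_lengths n (L : R) (lambda : 'I_n -> R)
    (C : 'I_n -> R -> R * R) (r : 'I_n -> R) :
  (forall i, 0 < lambda i) -> admissible L lambda C r ->
  exists l : 'I_n -> R,
    [/\ forall i, tangential_region (C i) (r i) (l i),
        forall i, r i = 2 * lambda i * l i, \sum_(i < n) l i = L &
        total_area C = (\sum_(i < n) lambda i * l i ^+ 2)%:E].
Proof.
move=> lambda0 [inC tanC triv sumL].
have /choice[l lP] : forall i, exists l, tangential_region (C i) (r i) l.
  by move=> i; exact: tangential_curve_region (lambda0 i) (inC i) (tanC i).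
exists l; split => //.
- by move=> i; exact: tangential_radius (inC i) (lP i).
- apply: EFin_inj; rewrite -sumL -sumEFin; apply: eq_bigr => i _.
  by rewrite (tr_length (lP i)).
- rewrite /total_area area_bigcup_ord//; last by move=> i; exact: tr_measurable (lP i).
  rewrite -sumEFin; apply: eq_bigr => i _.
  have [_ _ ->] := inC i; rewrite (tr_length (lP i)) -!EFinM; congr EFin; ring.
Qed.

(** If B bounds the absolute values of the abscissas in all the rescaled regions,
horizontal translations by multiples of 2 B + 1 make these regions disjoint. *)
Lemma admissible_rescale n (L : R) (lambda : 'I_n -> R) (C : 'I_n -> R -> R * R)
    (r l s : 'I_n -> R) :
  (forall i, in_class (lambda i) (C i)) -> (forall i, tangential_curve (r i) (C i)) ->
  (forall i, tangential_region (C i) (r i) (l i)) ->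
  (forall i, 0 < s i) -> \sum_(i < n) s i * l i = L ->
  exists C' : 'I_n -> R -> R * R, [/\ admissible L lambda C' (fun i => s i * r i) &
                 forall i, arc_length (C' i) = (s i * l i)%:E].
Proof.
move=> inC tanC trC s0 sumL.
have /choice[M MP] : forall i, exists M, forall p,
    region (C i) p -> `|p.1| <= M /\ `|p.2| <= M.
  by move=> i; have [_ _ /bounded_abs] := tr_region (trC i).
pose B := \sum_(i < n) s i * `|M i|.
have B0 : 0 <= B by apply: sumr_ge0 => i _; rewrite mulr_ge0// ltW.
have inB i p : region (C i) p -> `|s i * p.1| <= B.
  move=> /MP[p1 _]; rewrite normrM gtr0_norm// /B (bigD1 i)//=.
  rewrite (le_trans (ler_wpM2l (ltW (s0 i)) (le_trans p1 (ler_norm _))))// lerDl.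
  by apply: sumr_ge0 => j _; rewrite mulr_ge0// ltW.
pose d (i : 'I_n) : R * R := (i%:R * (2 * B + 1), 0).
exists (fun i => sim (s i) (d i) \o C i).
have lenE i : arc_length (sim (s i) (d i) \o C i) = (s i * l i)%:E.
  by apply: arc_length_sim (tr_length (trC i)); exact: ltW.
have regE i : region (sim (s i) (d i) \o C i) = sim (s i) (d i) @` region (C i).
  apply: region_sim; first exact: lt0r_neq0.
    exact: tr_region (trC i).
  exact: tr_convex (trC i).
split=> //; split.
- by move=> i; exact: in_class_sim (s0 i) (inC i) (trC i).
- move=> i; apply: tangential_curve_sim => //.
    exact: tr_region (trC i).
  exact: tr_convex (trC i).
- apply/trivIsetP => i j _ _; wlog ij : i j / (i < j)%N.
    move=> h; have [ij|ji|/val_inj->] := ltngtP i j; [exact: h| |by rewrite eqxx].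
    by rewrite eq_sym setIC; exact: h.
  move=> _; apply/seteqP; split => // y; rewrite !regE => -[[p Cp <-] [q Cq]].
  rewrite /sim /d/= => -[e _].
  have := inB _ _ Cp; have := inB _ _ Cq.
  rewrite !ler_norml => /andP[q1 q2] /andP[p1 p2].
  have ij1 : i%:R + 1 <= j%:R :> R by rewrite natr1 ler_nat.
  have : (i%:R + 1) * (2 * B + 1) <= j%:R * (2 * B + 1).
    by rewrite ler_wpM2r// addr_ge0// mulr_ge0.
  by lra.
- by rewrite -sumL -sumEFin; apply: eq_bigr => i _; exact: lenE.
Qed.

End competitors.

Section quadratic_form.
Context {R : realType}.

(** The mixed terms add up to 2 c sum_i (l_i - m_i) = 0. *)
Lemma weighted_square_deviation n (lambda l m : 'I_n -> R) (c : R) :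
  (forall i, lambda i * m i = c) -> \sum_(i < n) l i = \sum_(i < n) m i ->
  \sum_(i < n) lambda i * l i ^+ 2 =
  \sum_(i < n) lambda i * m i ^+ 2 + \sum_(i < n) lambda i * (l i - m i) ^+ 2.
Proof.
move=> mc lm; apply/eqP; rewrite -big_split /= -subr_eq0 -sumrB.
rewrite (eq_bigr (fun i => 2 * c * (l i - m i))).
  by rewrite -mulr_sumr sumrB lm subrr mulr0.
by move=> i _; rewrite -(mc i); ring.
Qed.

End quadratic_form.

Theorem corollary7 (R : realType) (n : nat) (hn : (2 <= n)%N)
    (L : R) (hL : 0 < L)
    (lambda : 'I_n -> R) (hlambda : forall i, 0 < lambda i)
    (C : 'I_n -> R -> R * R) (r : 'I_n -> R)
    (hC : admissible L lambda C r) :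
  (forall (C' : 'I_n -> R -> R * R) (r' : 'I_n -> R),
     admissible L lambda C' r' -> (total_area C <= total_area C')%E) <->
  (forall i j : 'I_n, r i = r j).
Proof.
have [l [trC rE sumL areaC]] := admissible_lengths hlambda hC.
have n0 : (0 < n)%N by exact: ltnW.
split=> [minC|requal C' r' hC'].
- (* The lengths m_i = c / lambda_i, with c fixed by the total length L. *)
  pose c := L / \sum_(i < n) (lambda i)^-1.
  have sum0 : 0 < \sum_(i < n) (lambda i)^-1.
    rewrite (bigD1 (Ordinal n0))//= ltr_pwDl ?invr_gt0//.
    by apply: sumr_ge0 => i _; rewrite invr_ge0 ltW.
  have c0 : 0 < c by rewrite divr_gt0.
  pose m i := c / lambda i.
  have m0 i : 0 < m i by rewrite divr_gt0.
  have mE i : lambda i * m i = c by rewrite mulrC divfK// gt_eqF.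
  have summ : \sum_(i < n) m i = L.
    by rewrite -mulr_sumr divfK// gt_eqF.
  pose s i := m i / l i.
  have sl i : s i * l i = m i by rewrite divfK// gt_eqF// (tr_length_gt0 (trC i)).
  have s0 i : 0 < s i by rewrite divr_gt0// (tr_length_gt0 (trC i)).
  have sumsl : \sum_(i < n) s i * l i = L by under eq_bigr do rewrite sl.
  have [inC tanC _ _] := hC.
  have [C' [hC' lenC']] := admissible_rescale inC tanC trC s0 sumsl.
  have [l' [trC' _ _ areaC']] := admissible_lengths hlambda hC'.
  have l'E i : l' i = m i.
    by apply: EFin_inj; rewrite -(tr_length (trC' i)) lenC' sl.
  have := minC _ _ hC'; rewrite areaC areaC' lee_fin.
  rewrite (weighted_square_deviation mE); last by rewrite sumL.
  under [leRHS]eq_bigr do rewrite l'E.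
  rewrite gerDl => dev_le0.
  have dev_ge0 i : 0 <= lambda i * (l i - m i) ^+ 2 by rewrite mulr_ge0 ?sqr_ge0// ltW.
  have lm i : l i = m i.
    have /eqP : \sum_(i < n) lambda i * (l i - m i) ^+ 2 = 0.
      by apply/eqP; rewrite eq_le dev_le0 sumr_ge0.
    rewrite psumr_eq0// => /allP/(_ i); rewrite mem_index_enum => /(_ isT).
    by rewrite mulf_eq0 gt_eqF//= sqrf_eq0 subr_eq0 => /eqP.
  by move=> i j; rewrite !rE -!mulrA !lm !mE.
- have [l' [_ _ sumL' areaC']] := admissible_lengths hlambda hC'.
  rewrite areaC areaC' lee_fin.
  pose i0 := Ordinal n0.
  have lc i : lambda i * l i = r i0 / 2 by rewrite (requal i0 i) rE; field.
  rewrite [leRHS](weighted_square_deviation lc); last by rewrite sumL.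
  by rewrite lerDl sumr_ge0// => i _; rewrite mulr_ge0 ?sqr_ge0// ltW.
Qed.
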